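(* For each $r\ge 0$ there is a functorial Turing-computable embedding from $\operatorname{FD}_r$ to $\operatorname{FD}_{r+1}$.
   Context: All structures are countable with universe $\omega$, identified with their atomic diagrams in $2^\omega$. $\operatorname{FD}_r$ is the class of fields of characteristic $0$ and transcendence degree $r$ over $\mathbb{Q}$, with universe $\omega$. A Turing-computable embedding of $K$ into $K'$ (classes closed under isomorphism) is a Turing operator $\Phi$ taking each structure of $K$ to a structure of $K'$ such that $\mathcal{A}\cong\mathcal{B}$ iff $\Phi(\mathcal{A})\cong\Phi(\mathcal{B})$. It is functorial if there is a Turing functional $\Phi_*$ such that for every isomorphism $f:\mathcal{B}\to\mathcal{B}'$ between structures of $K$, $\Phi_*^{\mathcal{B}\oplus f\oplus\mathcal{B}'}$ is an isomorphism $\Phi(\mathcal{B})\to\Phi(\mathcal{B}')$, and this assignment respects composition and preserves identity isomorphisms. *)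

(* Defs.v *)
From Stdlib Require Cantor.
From mathcomp Require Import all_boot all_order all_algebra.
From mathcomp.multinomials Require Import mpoly.

Set Implicit Arguments.
Unset Strict Implicit.
Unset Printing Implicit Defensive.

Import GRing.Theory.
Local Open Scope nat_scope.

(* Fields are structures with universe nat in the language {0, 1, +, *}. *)
Record structure := Structure {
  s_zero : nat;
  s_one : nat;
  s_add : nat -> nat -> nat;
  s_mul : nat -> nat -> nat }.

Record iso (A B : structure) (f : nat -> nat) : Prop := Iso {
  iso_bij : bijective f;
  iso_zero : f (s_zero A) = s_zero B;
  iso_one : f (s_one A) = s_one B;
  iso_add : forall a b, f (s_add A a b) = s_add B (f a) (f b);
  iso_mul : forall a b, f (s_mul A a b) = s_mul B (f a) (f b) }.

Definition isomorphic (A B : structure) : Prop := exists f, iso A B f.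

(* Closed terms with parameters from the universe; an atomic sentence is an
   equation between two of them. *)
Inductive term :=
| Zero
| One
| Par of nat
| Add of term & term
| Mul of term & term.

Fixpoint term_val (A : structure) (t : term) : nat :=
  match t with
  | Zero => s_zero A
  | One => s_one A
  | Par a => a
  | Add s t => s_add A (term_val A s) (term_val A t)
  | Mul s t => s_mul A (term_val A s) (term_val A t)
  end.

Fixpoint term_code (t : term) : nat :=
  match t with
  | Zero => 0
  | One => 1
  | Par a => (3 * a).+2
  | Add s t => (3 * Cantor.to_nat (term_code s, term_code t) + 1).+2
  | Mul s t => (3 * Cantor.to_nat (term_code s, term_code t) + 2).+2
  end.

(* [fuel] bounds the depth of the decoded term; [fuel = n.+1] is always enough,
   see [term_codeK]. *)
Fixpoint term_decode_rec (fuel n : nat) : term :=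
  match fuel, n with
  | k.+1, m.+2 =>
      let p := Cantor.of_nat (m %/ 3) in
      match m %% 3 with
      | 0 => Par (m %/ 3)
      | 1 => Add (term_decode_rec k p.1) (term_decode_rec k p.2)
      | _ => Mul (term_decode_rec k p.1) (term_decode_rec k p.2)
      end
  | _, 1 => One
  | _, _ => Zero
  end.

Definition term_decode (n : nat) : term := term_decode_rec n.+1 n.

(* The atomic diagram as an element of 2^omega: the n-th atomic sentence is the
   equation s = t, where n is the Cantor code of the codes of s and t. *)
Definition diagram (A : structure) (n : nat) : bool :=
  let p := Cantor.of_nat n in
  term_val A (term_decode p.1) == term_val A (term_decode p.2).

Lemma to_nat_ge (x y : nat) : x <= Cantor.to_nat (x, y) /\ y <= Cantor.to_nat (x, y).
Proof.
have /leP H := Cantor.to_nat_non_decreasing x y.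
by split; apply: leq_trans H; [apply: leq_addl | apply: leq_addr].
Qed.

Lemma term_decode_recK t k : term_code t < k -> term_decode_rec k (term_code t) = t.
Proof.
have mod3 N i : i < 3 -> (3 * N + i) %% 3 = i by move=> hi; rewrite mulnC modnMDl modn_small.
have div3 N i : i < 3 -> (3 * N + i) %/ 3 = N.
  by move=> hi; rewrite mulnC divnMDl // divn_small // addn0.
have sub N i k' : (3 * N + i).+2 < k'.+1 -> N < k'.
  rewrite ltnS; apply: leq_trans; rewrite ltnS; apply: leqW.
  by apply: leq_trans (leq_addr _ _); rewrite leq_pmull.
elim: t k => [||a|s IHs t IHt|s IHs t IHt] [|k] //.
- by move=> _; rewrite /term_code /term_decode_rec mulKn // modnMr.
- rewrite /term_code -/term_code => /sub hN.
  have [h1 h2] := to_nat_ge (term_code s) (term_code t).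
  rewrite /term_decode_rec -/term_decode_rec mod3 // div3 // Cantor.cancel_of_to.
  by rewrite IHs ?IHt //; apply: leq_ltn_trans hN.
- rewrite /term_code -/term_code => /sub hN.
  have [h1 h2] := to_nat_ge (term_code s) (term_code t).
  rewrite /term_decode_rec -/term_decode_rec mod3 // div3 // Cantor.cancel_of_to.
  by rewrite IHs ?IHt //; apply: leq_ltn_trans hN.
Qed.

Lemma term_codeK : cancel term_code term_decode.
Proof. by move=> t; apply: term_decode_recK. Qed.

Lemma diagramP (A : structure) (s t : term) :
  diagram A (Cantor.to_nat (term_code s, term_code t))
    = (term_val A s == term_val A t).
Proof. by rewrite /diagram Cantor.cancel_of_to /= !term_codeK. Qed.

Lemma diagram_inj (A B : structure) : diagram A =1 diagram B ->
  [/\ s_zero A = s_zero B, s_one A = s_one B,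
      s_add A =2 s_add B & s_mul A =2 s_mul B].
Proof.
move=> eqAB.
have H s : term_val A s = term_val B s.
  have := diagramP B s (Par (term_val A s)).
  by rewrite -eqAB diagramP /= eqxx => /esym/eqP.
split=> [||a b|a b]; [exact: (H Zero) | exact: (H One) | |].
- exact: (H (Add (Par a) (Par b))).
- exact: (H (Mul (Par a) (Par b))).
Qed.

(* Turing functionals, given by Kleene's schemes for partial functions that are
   recursive relative to an oracle X in omega^omega. *)

Inductive program :=
| PZero
| PSucc
| PProj of nat
| POracle
| PComp of program & seq program
| PRec of program & program
| PMu of program.

Fixpoint rec_graph (base : nat -> Prop) (step : nat -> nat -> nat -> Prop)
    (n y : nat) : Prop :=
  if n is k.+1 then exists2 z, rec_graph base step k z & step k z y
  else base y.

(* [eval X e v y]: the program e with oracle X halts on the argument list v with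
   output y. Arguments missing from v are read as 0. *)
Fixpoint eval (X : nat -> nat) (e : program) (v : seq nat) (y : nat) : Prop :=
  match e with
  | PZero => y = 0
  | PSucc => y = (nth 0 v 0).+1
  | PProj i => y = nth 0 v i
  | POracle => y = X (nth 0 v 0)
  | PComp f gs =>
      exists2 w : seq nat,
        (fix eval_all (gs : seq program) (w : seq nat) : Prop :=
           match gs, w with
           | [::], [::] => True
           | g :: gs', z :: w' => eval X g v z /\ eval_all gs' w'
           | _, _ => False
           end) gs w
        & eval X f w y
  | PRec f g =>
      rec_graph (eval X f (behead v))
        (fun k z => eval X g [:: k, z & behead v]) (nth 0 v 0) y
  | PMu f =>
      eval X f (y :: v) 0 /\
      forall z, z < y -> exists k, eval X f (z :: v) k.+1
  end.

Lemma eval_fun X : forall e v y y', eval X e v y -> eval X e v y' -> y = y'.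
Proof.
fix IH 1. case=> [||i||f gs|f g|f] v y y' /=; try by move=> -> ->.
- case=> w hw hf [w' hw' hf'].
  suff E: w = w' by subst; exact: (IH f) hf hf'.
  clear hf hf'. elim: gs w w' hw hw' => [|g gs IHg] [|a w] [|a' w'] //= [ha hw] [ha' hw'].
  rewrite (IH g _ _ _ ha ha') (IHg _ _ hw hw'). reflexivity.
- elim: (nth 0 v 0) y y' => [|k IHk] y y' /=; first exact: (IH f).
  case=> z hz h [z' hz' h']. rewrite -(IHk _ _ hz hz') in h'. exact: (IH g) h h'.
- case=> h hl [h' hl']. case: (ltngtP y y') => // lt.
  + have [k hk] := hl' _ lt. by have := IH f _ _ _ h hk.
  + have [k hk] := hl _ lt. by have := IH f _ _ _ h' hk.
Qed.

(* The functional e with oracle X is total and equal to Y. *)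
Definition computes (e : program) (X Y : nat -> nat) : Prop :=
  forall n, eval X e [:: n] (Y n).

Definition join (X Y : nat -> nat) (n : nat) : nat :=
  if odd n then Y n./2 else X n./2.

(* Phi(A) = B, for the Turing operator with program Phi. *)
Definition maps_to (Phi : program) (A B : structure) : Prop :=
  computes Phi (diagram A) (diagram B).

(* K and K' are meant to be closed under isomorphism, see [FD_iso_closed]. By
   [eval_fun] and [diagram_inj] the image of A under Phi is unique. *)
Record tc_embedding (K K' : structure -> Prop) (Phi : program) : Prop := {
  tc_total : forall A, K A -> exists2 B, K' B & maps_to Phi A B;
  tc_iso : forall A A' B B', K A -> K A' -> maps_to Phi A B -> maps_to Phi A' B' ->
    isomorphic A A' <-> isomorphic B B' }.

Definition iso_oracle (A A' : structure) (f : nat -> nat) : nat -> nat :=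
  join (join (diagram A) f) (diagram A').

Record functorial (K : structure -> Prop) (Phi Phis : program) : Prop := {
  fun_iso : forall A A' B B' f, K A -> K A' -> iso A A' f ->
    maps_to Phi A B -> maps_to Phi A' B' ->
    exists2 g, computes Phis (iso_oracle A A' f) g & iso B B' g;
  fun_id : forall A, K A -> computes Phis (iso_oracle A A id) id;
  fun_comp : forall A A' A'' f f' g g',
    K A -> K A' -> K A'' -> iso A A' f -> iso A' A'' f' ->
    computes Phis (iso_oracle A A' f) g ->
    computes Phis (iso_oracle A' A'' f') g' ->
    computes Phis (iso_oracle A A'' (f' \o f)) (g' \o g) }.

(* The transcendence degree is taken over the prime field Q: [ratr] embeds rat
   into F only when F has characteristic 0, as it does in [FD]. *)
Section TranscendenceDegree.
Variable F : fieldType.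
Local Open Scope ring_scope.

Definition rat_eval n (x : 'I_n -> F) (p : {mpoly rat[n]}) : F :=
  mmap (ratr : rat -> F) x p.

Definition alg_independent n (x : 'I_n -> F) : Prop :=
  forall p : {mpoly rat[n]}, rat_eval x p = 0 -> p = 0.

(* membership of z in the subfield Q(x_0, ..., x_{n-1}) *)
Definition in_adjoin n (x : 'I_n -> F) (z : F) : Prop :=
  exists p q : {mpoly rat[n]}, rat_eval x q != 0 /\ z = rat_eval x p / rat_eval x q.

Definition algebraic_over (S : F -> Prop) (y : F) : Prop :=
  exists p : {poly F}, [/\ p != 0, forall i, S p`_i & root p y].

Definition has_trdeg (n : nat) : Prop :=
  exists x : 'I_n -> F,
    alg_independent x /\ forall y, algebraic_over (in_adjoin x) y.

End TranscendenceDegree.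

(* [phi] identifies the structure A with the field F. *)
Record presents (A : structure) (F : fieldType) (phi : nat -> F) : Prop := {
  pres_bij : bijective phi;
  pres_zero : phi (s_zero A) = 0%R;
  pres_one : phi (s_one A) = 1%R;
  pres_add : forall a b, phi (s_add A a b) = (phi a + phi b)%R;
  pres_mul : forall a b, phi (s_mul A a b) = (phi a * phi b)%R }.

Definition FD (r : nat) (A : structure) : Prop :=
  exists (F : fieldType) (phi : nat -> F),
    [/\ presents A phi, [pchar F]%R =i pred0 & has_trdeg F r].

Lemma FD_iso_closed (r : nat) (A B : structure) :
  isomorphic A B -> FD r A -> FD r B.
Proof.
move=> [f [[g fK gK] f0 f1 fD fM]] [F [phi [[bphi p0 p1 pD pM] cF tF]]].
exists F, (phi \o g); split=> //; split=> [|||a b|a b] /=.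
- by apply: bij_comp bphi _; exists f.
- by rewrite -f0 fK.
- by rewrite -f1 fK.
- by rewrite -{1}[a]gK -{1}[b]gK -fD fK pD.
- by rewrite -{1}[a]gK -{1}[b]gK -fM fK pM.
Qed.

(* Main.v *)
(** Let F have characteristic 0. Inside F[[z]] let R be the smallest subring
containing F and z and closed under the map xi sending t to the solution x of
x = t + z x^2, and let K be the fraction field of R; K is algebraic over F(z).

K determines F. Since (1 - 2 z xi(t))^2 = 1 - 4 z t, every element of 1 + z R is
a 2^n-th power for all n, whereas a nonzero element of K with this property is a unit
of F[[z]], because the z-adic valuation takes values in the integers. It follows
that y in K is a power series if and only if, for some w <> 0, every 1 + w y^n
has 2^n-th roots for all n. So an isomorphism between two such K respects their
valuation rings and induces an isomorphism of the residue fields F.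

K is computable from F. Elements of R are values of terms over F. If [One]
occurs h times in a term with value f, then z^h f is an eigenvalue of a matrix
over F[z] of size at most 2^h with entries of degree at most 2 h; a nonzero f
therefore has a nonzero coefficient of index at most 2^h * 2 h, and equality in
K is decided by computing finitely many coefficients. *)

Require Import Defs.
From Stdlib Require Cantor.
From HB Require Import structures.
From mathcomp Require Import all_boot all_order all_algebra.
From mathcomp Require Import boolp.
From mathcomp.multinomials Require Import mpoly.
From mathcomp Require Import ring zify.

Set Implicit Arguments.
Unset Strict Implicit.
Unset Printing Implicit Defensive.

Import GRing.Theory.

(** * Programs *)

Local Open Scope nat_scope.

(** The rational function field F(z) would be a computable and functorial choice, but it need not
    determine F, since cancellation fails for purely transcendental extensions. Roots of 1-units
    have to be added to make the valuation ring visible to the field structure. They are added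
    through xi because xi is a total operation on F[[z]] with a uniquely determined value: no root
    has to be chosen and no existence of roots decided. Every element of K is thus named by a
    quotient of two terms with parameters in F, and an isomorphism of base fields acts on names by
    renaming parameters. This is the source of functoriality. Conversely, an isomorphism between two
    fields K need not respect the base fields or z, so F must be recovered by a condition that
    mentions neither, and only as a residue field. *)

Section Computable.
Variables (I : Type) (o : I -> nat -> nat).

(** One program is quantified before the index, because a Turing operator must be uniform in its
    oracle: [I] ranges over all structures (later, all isomorphisms) at once, and [o i] is the
    oracle that [i] supplies. *)
Definition cmp m (f : I -> seq nat -> nat) : Prop :=
  exists e, forall i v, size v = m -> eval (o i) e v (f i v).

Definition cmp1 (f : I -> nat -> nat) := cmp 1 (fun i v => f i (nth 0 v 0)).
Definition cmp2 (f : I -> nat -> nat -> nat) :=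
  cmp 2 (fun i v => f i (nth 0 v 0) (nth 0 v 1)).
Definition cmp3 (f : I -> nat -> nat -> nat -> nat) :=
  cmp 3 (fun i v => f i (nth 0 v 0) (nth 0 v 1) (nth 0 v 2)).
Definition cmp4 (f : I -> nat -> nat -> nat -> nat -> nat) :=
  cmp 4 (fun i v => f i (nth 0 v 0) (nth 0 v 1) (nth 0 v 2) (nth 0 v 3)).

Lemma cmp_ext m f g : (forall i v, size v = m -> f i v = g i v) ->
  cmp m f -> cmp m g.
Proof. by move=> fg [e he]; exists e => i v sv; rewrite -fg //; apply: he. Qed.

Lemma cmp_proj m k : cmp m (fun _ v => nth 0 v k).
Proof. by exists (PProj k). Qed.

Lemma cmp_comp k m f (gs : seq (I -> seq nat -> nat)) : cmp k f -> size gs = k ->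
  (forall j, j < k -> cmp m (nth (fun _ _ => 0) gs j)) ->
  cmp m (fun i v => f i [seq g i v | g <- gs]).
Proof.
case=> e he sgs hgs.
have [es [ses hes]] : exists es, size es = size gs /\ forall i v, size v = m ->
    forall j, j < size gs -> eval (o i) (nth PZero es j) v (nth (fun _ _ => 0) gs j i v).
  rewrite -sgs in hgs; elim: gs hgs {sgs} => [_|g gs IH hgs]; first by exists [::].
  have [eg heg] := hgs 0 isT; have [j lt|es [ses hes]] := IH; first exact: (hgs j.+1).
  exists (eg :: es); split=> [|i v sv [|j] lt] /=; [by rewrite ses|exact: heg|exact: hes].
exists (PComp e es) => i v sv; exists [seq g i v | g <- gs]; last first.
  by apply: he; rewrite size_map.
have := hes i v sv; elim: es gs ses {hgs sgs hes} => [|e' es IH] [|g gs] //= [ses] h.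
by split; [apply: (h 0)|apply: IH => // j lt; apply: (h j.+1)].
Qed.

Lemma app1 f m a : cmp1 f -> cmp m a -> cmp m (fun i v => f i (a i v)).
Proof.
move=> hf ha; apply: (@cmp_comp 1 m _ [:: a] hf) => //.
by case.
Qed.

Lemma app2 f m a b : cmp2 f -> cmp m a -> cmp m b ->
  cmp m (fun i v => f i (a i v) (b i v)).
Proof.
move=> hf ha hb; apply: (@cmp_comp 2 m _ [:: a; b] hf) => //.
by case=> [|[]].
Qed.

Lemma app3 f m a b c : cmp3 f -> cmp m a -> cmp m b -> cmp m c ->
  cmp m (fun i v => f i (a i v) (b i v) (c i v)).
Proof.
move=> hf ha hb hc; apply: (@cmp_comp 3 m _ [:: a; b; c] hf) => //.
by case=> [|[|[]]].
Qed.

Lemma app4 f m a b c d : cmp4 f -> cmp m a -> cmp m b -> cmp m c -> cmp m d ->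
  cmp m (fun i v => f i (a i v) (b i v) (c i v) (d i v)).
Proof.
move=> hf ha hb hc hd; apply: (@cmp_comp 4 m _ [:: a; b; c; d] hf) => //.
by case=> [|[|[|[]]]].
Qed.

Lemma cmp_succ m a : cmp m a -> cmp m (fun i v => (a i v).+1).
Proof. by apply: (@app1 (fun _ n => n.+1)); exists PSucc. Qed.

Lemma cmp_const m c : cmp m (fun _ _ => c).
Proof. by elim: c => [|c IH]; [exists PZero|apply: cmp_succ IH]. Qed.

Lemma cmp_oracle m a : cmp m a -> cmp m (fun i v => o i (a i v)).
Proof. by apply: app1; exists POracle => i v _. Qed.

Lemma cmp_rec m b s : cmp m b -> cmp m.+2 s ->
  cmp m.+1 (fun i v => nat_rec (fun=> nat) (b i (behead v))
    (fun k z => s i [:: k, z & behead v]) (nth 0 v 0)).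
Proof.
case=> [eb hb] [es hs]; exists (PRec eb es) => i [|n v] //= [sv].
elim: n => [|n IH] /=; first exact: hb.
exists (nat_rec (fun=> nat) (b i v) (fun k z => s i [:: k, z & v]) n) => //.
by apply: hs; rewrite /= sv.
Qed.

Lemma rec0 (b : I -> nat) (s : I -> nat -> nat -> nat) :
  cmp 0 (fun i _ => b i) -> cmp2 s ->
  cmp1 (fun i n => nat_rec (fun=> nat) (b i) (fun k z => s i k z) n).
Proof. by move=> hb hs; apply: cmp_ext (cmp_rec hb hs) => i [|n [|]]. Qed.

Lemma rec1 (b : I -> nat -> nat) (s : I -> nat -> nat -> nat -> nat) :
  cmp1 b -> cmp3 s ->
  cmp2 (fun i n x => nat_rec (fun=> nat) (b i x) (fun k z => s i k z x) n).
Proof. by move=> hb hs; apply: cmp_ext (cmp_rec hb hs) => i [|n [|x [|]]]. Qed.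

Lemma rec2 (b : I -> nat -> nat -> nat) (s : I -> nat -> nat -> nat -> nat -> nat) :
  cmp2 b -> cmp4 s ->
  cmp3 (fun i n x y => nat_rec (fun=> nat) (b i x y) (fun k z => s i k z x y) n).
Proof. by move=> hb hs; apply: cmp_ext (cmp_rec hb hs) => i [|n [|x [|y [|]]]]. Qed.

Lemma cmp_mu m (p : I -> seq nat -> nat) g : cmp m.+1 p ->
  (forall i v, size v = m -> p i (g i v :: v) = 0 /\
     forall z, z < g i v -> p i (z :: v) != 0) -> cmp m g.
Proof.
case=> e he hg; exists (PMu e) => i v sv; have [h0 h1] := hg i v sv; split.
  by rewrite -h0; apply: he; rewrite /= sv.
move=> z lt; have := h1 z lt; have /= := he i (z :: v); rewrite sv => /(_ erefl).
by case: (p i (z :: v)) => // k hk _; exists k.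
Qed.

Lemma cmp_pred : cmp1 (fun _ n => n.-1).
Proof.
apply: cmp_ext (@rec0 (fun=> 0) (fun _ k _ => k) (cmp_const _ _) (cmp_proj _ _)).
by move=> i [|n []] //=; case: n.
Qed.

Lemma cmp_addn : cmp2 (fun _ m n => m + n).
Proof.
apply: cmp_ext (@rec1 (fun _ x => x) (fun _ _ z _ => z.+1) (cmp_proj _ _) _) => [i v _|].
  by elim: (nth 0 v 0) => //= n ->.
exact/cmp_succ/cmp_proj.
Qed.

Lemma cmp_muln : cmp2 (fun _ m n => m * n).
Proof.
apply: cmp_ext (@rec1 (fun _ _ => 0) (fun _ _ z x => x + z) (cmp_const _ _) _) => [i v _|].
  by elim: (nth 0 v 0) => //= n ->.
exact: (app2 cmp_addn (cmp_proj _ _) (cmp_proj _ _)).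
Qed.

Lemma cmp_subn : cmp2 (fun _ m n => m - n).
Proof.
pose H := @rec1 (fun _ x => x) (fun _ _ z _ => z.-1) (cmp_proj _ _)
  (app1 cmp_pred (cmp_proj _ _)).
apply: cmp_ext (app2 H (cmp_proj 2 1) (cmp_proj 2 0)) => i v _.
by elim: (nth 0 v 1) => [|n /= ->]; rewrite ?subn0 ?subnS.
Qed.


Lemma cmp_eqn : cmp2 (fun _ m n => m == n).
Proof.
have h1 := app2 cmp_addn (app2 cmp_subn (cmp_proj 2 0) (cmp_proj 2 1))
  (app2 cmp_subn (cmp_proj 2 1) (cmp_proj 2 0)).
apply: cmp_ext (app2 cmp_subn (cmp_const 2 1) h1) => i v _.
case: eqVneq; lia.
Qed.

Lemma cmp_leq : cmp2 (fun _ m n => m <= n).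
Proof.
have h1 := app2 cmp_subn (cmp_proj 2 0) (cmp_proj 2 1).
apply: cmp_ext (app2 cmp_subn (cmp_const 2 1) h1) => i v _.
case: leqP; lia.
Qed.

Lemma cmp_negb m (p : I -> seq nat -> bool) : cmp m p -> cmp m (fun i v => ~~ p i v).
Proof.
move=> hp; apply: cmp_ext (app2 cmp_subn (cmp_const m 1) hp) => i v _.
by case: (p i v).
Qed.

Lemma cmp_andb m (p q : I -> seq nat -> bool) : cmp m p -> cmp m q ->
  cmp m (fun i v => p i v && q i v).
Proof.
move=> hp hq; apply: cmp_ext (app2 cmp_muln hp hq) => i v _.
by case: (p i v); case: (q i v).
Qed.

Lemma cmp_if m (p : I -> seq nat -> bool) a b : cmp m p -> cmp m a -> cmp m b ->
  cmp m (fun i v => if p i v then a i v else b i v).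
Proof.
move=> hp ha hb; apply: cmp_ext (app2 cmp_addn (app2 cmp_muln hp ha)
  (app2 cmp_muln (cmp_negb hp) hb)) => i v _.
by case: (p i v); rewrite /= ?mul1n ?mul0n ?addn0.
Qed.

(** The search halts because [g i v] is a witness, and leastness identifies its result. Functions
    known only through a decidable graph, such as the operations of a structure given by its
    diagram, are computed in this way. *)
Lemma cmp_search m (p : I -> seq nat -> bool) g : cmp m.+1 p ->
  (forall i v, size v = m -> p i (g i v :: v) /\
     forall z, p i (z :: v) -> g i v <= z) -> cmp m g.
Proof.
move=> hp hg; apply: (cmp_mu (cmp_negb hp)) => i v sv; have [h0 h1] := hg i v sv.
split; first by rewrite h0.
by move=> z lt; case: (boolP (p i (z :: v))) => // /h1; rewrite leqNgt lt.
Qed.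

Definition all_below n (p : nat -> bool) : bool :=
  nat_rec (fun=> bool) true (fun k b => b && p k) n.

Lemma all_belowP n (p : nat -> bool) : reflect (forall k, k < n -> p k) (all_below n p).
Proof.
elim: n => [|n IH] /=; first by left.
apply: (iffP andP) => [[/IH h pn] k|h]; last first.
  by split; [apply/IH => k lt; apply: h; apply: leqW|apply: h].
by rewrite ltnS leq_eqVlt => /orP[/eqP -> //|]; apply: h.
Qed.

Lemma cmp_all_below1 (p : I -> nat -> nat -> bool) :
  cmp2 p -> cmp2 (fun i n x => all_below n (fun k => p i k x)).
Proof.
move=> hp; have hs : cmp3 (fun i k z x => if 0 < z then p i k x else false).
  apply: cmp_ext (cmp_if (app2 cmp_leq (cmp_const 3 1) (cmp_proj 3 1))
    (app2 hp (cmp_proj 3 0) (cmp_proj 3 2)) (cmp_const 3 0)) => i v _.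
  by case: ifP.
apply: cmp_ext (rec1 (b := fun _ _ => 1) (cmp_const 1 1) hs) => i v _.
by elim: (nth 0 v 0) => //= n ->; case: all_below.
Qed.

Lemma cmp_all_below2 (p : I -> nat -> nat -> nat -> bool) :
  cmp3 p -> cmp3 (fun i n x y => all_below n (fun k => p i k x y)).
Proof.
move=> hp; have hs : cmp4 (fun i k z x y => if 0 < z then p i k x y else false).
  apply: cmp_ext (cmp_if (app2 cmp_leq (cmp_const 4 1) (cmp_proj 4 1))
    (app3 hp (cmp_proj 4 0) (cmp_proj 4 2) (cmp_proj 4 3)) (cmp_const 4 0)) => i v _.
  by case: ifP.
apply: cmp_ext (rec2 (b := fun _ _ _ => 1) (cmp_const 2 1) hs) => i v _.
by elim: (nth 0 v 0) => //= n ->; case: all_below.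
Qed.

Definition cpair x y := Cantor.to_nat (x, y).
Definition fstc n := (Cantor.of_nat n).1.
Definition sndc n := (Cantor.of_nat n).2.

Lemma fstcK x y : fstc (cpair x y) = x. Proof. by rewrite /fstc Cantor.cancel_of_to. Qed.
Lemma sndcK x y : sndc (cpair x y) = y. Proof. by rewrite /sndc Cantor.cancel_of_to. Qed.
Lemma paircK n : cpair (fstc n) (sndc n) = n.
Proof. by rewrite /cpair /fstc /sndc -surjective_pairing Cantor.cancel_to_of. Qed.
Lemma fstc_le n : fstc n <= n.
Proof. by have [] := to_nat_ge (fstc n) (sndc n); rewrite -/(cpair _ _) paircK. Qed.
Lemma sndc_le n : sndc n <= n.
Proof. by have [] := to_nat_ge (fstc n) (sndc n); rewrite -/(cpair _ _) paircK. Qed.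

Lemma cmp_pair : cmp2 (fun _ x y => cpair x y).
Proof.
have hs := app2 cmp_addn (cmp_succ (cmp_proj 2 0)) (cmp_proj 2 1).
(* [Cantor.to_nat (x, y)] is [y] plus the triangular number of [y + x]; this recursion is the
   triangular number. *)
have ht : cmp1 (fun _ n => nat_rec (fun=> nat) 0 (fun i m => i.+1 + m) n).
  exact: (rec0 (cmp_const 0 0) hs).
have hyx := app2 cmp_addn (cmp_proj 2 1) (cmp_proj 2 0).
exact: cmp_ext (app2 cmp_addn (cmp_proj 2 1) (app1 ht hyx)).
Qed.

(** The pairing is inverted by search. The matching second component is at most [n], so its
    existence is a bounded quantifier, written as the negation of an [all_below]. *)
Lemma cmp_fstc : cmp1 (fun _ n => fstc n).
Proof.
have h : cmp3 (fun _ k x n => cpair x k != n).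
  exact: (cmp_negb (app2 cmp_eqn (app2 cmp_pair (cmp_proj 3 1) (cmp_proj 3 0)) (cmp_proj 3 2))).
have := cmp_negb (app3 (cmp_all_below2 h) (cmp_succ (cmp_proj 2 1)) (cmp_proj 2 0) (cmp_proj 2 1)).
move/cmp_search; apply => i [|n [|]] // _; split=> [|x].
  apply/negP => /(elimT (all_belowP n.+1 _))/(_ (sndc n)); rewrite ltnS sndc_le.
  by move=> /(_ isT); rewrite /= paircK eqxx.
apply: contraR => hx; apply/(introT (all_belowP n.+1 _)) => k _.
by apply: contra hx => /eqP /= <-; rewrite fstcK.
Qed.

Lemma cmp_sndc : cmp1 (fun _ n => sndc n).
Proof.
have h : cmp2 (fun _ y n => cpair (fstc n) y == n).
  apply: (app2 cmp_eqn (app2 cmp_pair (app1 cmp_fstc (cmp_proj 2 1)) (cmp_proj 2 0)) (cmp_proj 2 1)).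
move/cmp_search: h; apply => i [|n [|]] //= _; rewrite paircK eqxx; split=> // y /eqP <-.
by rewrite sndcK.
Qed.

Lemma cmp_div3 : cmp1 (fun _ n => n %/ 3).
Proof.
have h : cmp2 (fun _ q n => n < 3 * q.+1).
  exact: (app2 cmp_leq (cmp_succ (cmp_proj 2 1))
    (app2 cmp_muln (cmp_const 2 3) (cmp_succ (cmp_proj 2 0)))).
by move/cmp_search: h; apply => i [|n [|]] //= _; split=> [|q]; lia.
Qed.

Lemma cmp_mod3 : cmp1 (fun _ n => n %% 3).
Proof.
have h := app2 cmp_subn (cmp_proj 1 0)
  (app2 cmp_muln (cmp_const 1 3) (app1 cmp_div3 (cmp_proj 1 0))).
by apply: cmp_ext h => i v _; lia.
Qed.

Lemma cmp_exp2 : cmp1 (fun _ n => 2 ^ n).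
Proof.
have hs : cmp2 (fun _ _ z => 2 * z).
  exact: (app2 cmp_muln (cmp_const 2 2) (cmp_proj 2 1)).
have h := rec0 (b := fun _ => 1) (cmp_const 0 1) hs.
by apply: cmp_ext h => i v _; elim: (nth 0 v 0) => //= n ->; rewrite expnS.
Qed.

(* tables: the list [H (n-1) T_{n-1}; ...; H 0 T_0], where T_k is its tail of
   length k *)
Definition tab (H : nat -> nat -> nat) n : nat :=
  nat_rec (fun=> nat) 0 (fun k T => (cpair (H k T) T).+1) n.
Definition drop_tab n T : nat := nat_rec (fun=> nat) T (fun _ T => sndc T.-1) n.
(** The newest entry is at the head, so entry [k] of a table of length [n] lies [n.-1 - k] steps
    down. The predecessor undoes the successor that tells a nonempty table from the empty one. *)
Definition look n T k : nat := fstc (drop_tab (n.-1 - k) T).-1.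

Lemma drop_tabE H n d : d <= n -> drop_tab d (tab H n) = tab H (n - d).
Proof.
elim: d => [|d IH] le; first by rewrite subn0.
by rewrite /= IH; [rewrite -(subnSK le) /= sndcK|apply: ltnW].
Qed.

Lemma look_tab H n k : k < n -> look n (tab H n) k = H k (tab H k).
Proof.
move=> lt; rewrite /look drop_tabE; last by lia.
have -> : n - (n.-1 - k) = k.+1 by lia.
by rewrite /= fstcK.
Qed.

Lemma cmp_look : cmp3 (fun _ n T k => look n T k).
Proof.
have h : cmp2 (fun _ n T => drop_tab n T).
  exact: (rec1 (cmp_proj 1 0) (app1 cmp_sndc (app1 cmp_pred (cmp_proj 3 1)))).
have hn := app2 cmp_subn (app1 cmp_pred (cmp_proj 3 0)) (cmp_proj 3 2).
exact: (app1 cmp_fstc (app1 cmp_pred (app2 h hn (cmp_proj 3 1)))).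
Qed.

Lemma cmp_tab1 (H : I -> nat -> nat -> nat -> nat) : cmp3 H ->
  cmp2 (fun i n x => tab (fun k T => H i k T x) n).
Proof.
move=> hH; apply: (rec1 (b := fun _ _ => 0) (cmp_const 1 0)).
exact: (cmp_succ (app2 cmp_pair (app3 hH (cmp_proj 3 0) (cmp_proj 3 1) (cmp_proj 3 2))
  (cmp_proj 3 1))).
Qed.

Lemma cmp_tab2 (H : I -> nat -> nat -> nat -> nat -> nat) : cmp4 H ->
  cmp3 (fun i n x y => tab (fun k T => H i k T x y) n).
Proof.
move=> hH; apply: (rec2 (b := fun _ _ _ => 0) (cmp_const 2 0)).
exact: (cmp_succ (app2 cmp_pair (app4 hH (cmp_proj 4 0) (cmp_proj 4 1) (cmp_proj 4 2)
  (cmp_proj 4 3)) (cmp_proj 4 1))).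
Qed.

End Computable.

Ltac cmp_step :=
  lazymatch goal with
  | |- cmp1 _ _ => rewrite /cmp1
  | |- cmp2 _ _ => rewrite /cmp2
  | |- cmp3 _ _ => rewrite /cmp3
  | |- cmp4 _ _ => rewrite /cmp4
  | |- cmp _ _ (fun _ v => nth 0 v _) => apply: cmp_proj
  | |- cmp _ _ (fun _ _ => addn _ _) => refine (app2 (cmp_addn _) _ _)
  | |- cmp _ _ (fun _ _ => subn _ _) => refine (app2 (cmp_subn _) _ _)
  | |- cmp _ _ (fun _ _ => muln _ _) => refine (app2 (cmp_muln _) _ _)
  | |- cmp _ _ (fun _ _ => S _) => refine (cmp_succ _)
  | |- cmp _ _ (fun _ _ => predn _) => refine (app1 (cmp_pred _) _)
  | |- cmp _ _ (fun _ _ => expn 2 _) => refine (app1 (cmp_exp2 _) _)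
  | |- cmp _ _ (fun _ _ => divn _ 3) => refine (app1 (cmp_div3 _) _)
  | |- cmp _ _ (fun _ _ => modn _ 3) => refine (app1 (cmp_mod3 _) _)
  | |- cmp _ _ (fun _ _ => cpair _ _) => refine (app2 (cmp_pair _) _ _)
  | |- cmp _ _ (fun _ _ => fstc _) => refine (app1 (cmp_fstc _) _)
  | |- cmp _ _ (fun _ _ => sndc _) => refine (app1 (cmp_sndc _) _)
  | |- cmp _ _ (fun _ _ => look _ _ _) => refine (app3 (cmp_look _) _ _ _)
  | |- cmp _ _ (fun _ _ => nat_of_bool (andb _ _)) => refine (cmp_andb _ _)
  | |- cmp _ _ (fun _ _ => nat_of_bool (negb _)) => refine (cmp_negb _)
  | |- cmp _ _ (fun _ _ => nat_of_bool (leq _ _)) => refine (app2 (cmp_leq _) _ _)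
  | |- cmp _ _ (fun _ _ => nat_of_bool (@eq_op _ _ _)) => refine (app2 (cmp_eqn _) _ _)
  | |- cmp _ _ (fun _ _ => if _ then _ else _) => refine (cmp_if _ _ _)
  | H : cmp1 _ ?f |- cmp _ _ (fun i v => ?f i _) => refine (app1 H _)
  | H : cmp2 _ ?f |- cmp _ _ (fun i v => ?f i _ _) => refine (app2 H _ _)
  | H : cmp3 _ ?f |- cmp _ _ (fun i v => ?f i _ _ _) => refine (app3 H _ _ _)
  | H : cmp4 _ ?f |- cmp _ _ (fun i v => ?f i _ _ _ _) => refine (app4 H _ _ _ _)
  | _ => apply: cmp_const
  end.
Ltac cmp_auto := repeat cmp_step.

(** * Recursion on coded terms *)

Section TermFold.
Variables (z u : nat) (par : nat -> nat) (add mul : nat -> nat -> nat) (ksi : nat -> nat).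

(** [Mul One t] has its own case because it will name xi of the value of [t]. A fold that wants the
    ordinary meaning of products takes for [ksi] the multiplication by the value of [One]. *)
Fixpoint tfold (t : term) : nat :=
  match t with
  | Zero => z
  | One => u
  | Par a => par a
  | Add s t => add (tfold s) (tfold t)
  | Mul One t => ksi (tfold t)
  | Mul s t => mul (tfold s) (tfold t)
  end.

(** Course-of-values recursion on codes: [T] tabulates the fold below [c], where the codes of the
    immediate subterms lie. Testing [fstc d == 1] detects a left factor [One], since no other code
    decodes to it. *)
Definition fold_step c T : nat :=
  if c == 0 then z else if c == 1 then u else
  let m := c.-1.-1 in let d := m %/ 3 in
  if m %% 3 == 0 then par d else
  if m %% 3 == 1 then add (look c T (fstc d)) (look c T (sndc d)) else
  if fstc d == 1 then ksi (look c T (sndc d))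
  else mul (look c T (fstc d)) (look c T (sndc d)).

Lemma fold_stepS m T : fold_step m.+2 T = let d := m %/ 3 in
  if m %% 3 == 0 then par d else
  if m %% 3 == 1 then add (look m.+2 T (fstc d)) (look m.+2 T (sndc d)) else
  if fstc d == 1 then ksi (look m.+2 T (sndc d))
  else mul (look m.+2 T (fstc d)) (look m.+2 T (sndc d)).
Proof. by []. Qed.

Lemma term_decode_fuel k l n : n < k -> n < l -> term_decode_rec k n = term_decode_rec l n.
Proof.
elim: k l n => // k IH [|l] // [|[|m]] // hk hl; rewrite /= -!/(fstc _) -!/(sndc _).
have d3 : m %/ 3 <= m by apply: leq_div.
have h1 : fstc (m %/ 3) <= m by apply: leq_trans (fstc_le _) d3.
have h2 : sndc (m %/ 3) <= m by apply: leq_trans (sndc_le _) d3.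
by case: (m %% 3) => [|[|?]] //; rewrite (IH l (fstc _)) ?(IH l (sndc _)) //; lia.
Qed.

Lemma term_decodeS m : term_decode m.+2 =
  let d := m %/ 3 in
  match m %% 3 with
  | 0 => Par d
  | 1 => Add (term_decode (fstc d)) (term_decode (sndc d))
  | _ => Mul (term_decode (fstc d)) (term_decode (sndc d))
  end.
Proof.
rewrite {1}/term_decode /= -!/(fstc _) -!/(sndc _).
have d3 : m %/ 3 <= m by apply: leq_div.
have h1 : fstc (m %/ 3) <= m by apply: leq_trans (fstc_le _) d3.
have h2 : sndc (m %/ 3) <= m by apply: leq_trans (sndc_le _) d3.
have e x : x <= m -> term_decode_rec m.+2 x = term_decode x.
  by move=> hx; apply: term_decode_fuel; lia.
by case: (m %% 3) => [|[|?]] //; rewrite -!e.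
Qed.

Lemma term_decode_One c : (term_decode c = One) -> c = 1.
Proof.
case: c => [|[|m]] //; rewrite term_decodeS /=.
by case: (m %% 3) => [|[|?]].
Qed.

Lemma tfoldE c : tfold (term_decode c) = fold_step c (tab fold_step c).
Proof.
elim/ltn_ind: c => -[|[|m]] // IH.
rewrite term_decodeS fold_stepS; lazy zeta.
have d3 : m %/ 3 <= m by apply: leq_div.
have h1 : fstc (m %/ 3) < m.+2 by have := fstc_le (m %/ 3); lia.
have h2 : sndc (m %/ 3) < m.+2 by have := sndc_le (m %/ 3); lia.
rewrite (look_tab fold_step h1) (look_tab fold_step h2) -!IH //; clear.
case: (m %% 3) => [|[|n]] //; rewrite [LHS]/=.
case: eqP => [->|ne] //.
by case E : (term_decode (fstc _)) => //; case: ne; apply: term_decode_One.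
Qed.

End TermFold.

Section CmpFold.
Variables (I : Type) (o : I -> nat -> nat).
Variables (z u : I -> nat -> nat) (par : I -> nat -> nat -> nat)
  (add mul : I -> nat -> nat -> nat -> nat) (ksi : I -> nat -> nat -> nat).
Hypotheses (hz : cmp1 o z) (hu : cmp1 o u) (hpar : cmp2 o par)
  (hadd : cmp3 o add) (hmul : cmp3 o mul) (hxi : cmp2 o ksi).

Lemma cmp_tfold : cmp2 o (fun i p c =>
  tfold (z i p) (u i p) (par i p) (add i p) (mul i p) (ksi i p) (term_decode c)).
Proof.
pose H i c T p := fold_step (z i p) (u i p) (par i p) (add i p) (mul i p) (ksi i p) c T.
have hH : cmp3 o H by rewrite /H /fold_step; cmp_auto.
have hT := cmp_tab1 hH.
have hG : cmp2 o (fun i p c => H i c (tab (fun k T => H i k T p) c) p).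
  exact: (app3 hH (cmp_proj o 2 1) (app2 hT (cmp_proj o 2 1) (cmp_proj o 2 0)) (cmp_proj o 2 0)).
by apply: cmp_ext hG => i v _; rewrite tfoldE.
Qed.

End CmpFold.

(** * Relativization: replacing the oracle by a program *)

Section Relativize.
Variables (X Y : nat -> nat) (e0 : program).
Hypothesis e0Y : forall v, eval X e0 v (Y (nth 0 v 0)).

Fixpoint subst_oracle (e : program) : program :=
  match e with
  | POracle => e0
  | PComp f gs => PComp (subst_oracle f) (map subst_oracle gs)
  | PRec f g => PRec (subst_oracle f) (subst_oracle g)
  | PMu f => PMu (subst_oracle f)
  | e => e
  end.

Lemma eval_subst : forall e v y, eval Y e v y -> eval X (subst_oracle e) v y.
Proof.
fix IH 1. case=> [||i||f gs|f g|f] v y //=.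
- by move=> ->; apply: e0Y.
- case=> w hw hf; exists w; last exact: IH.
  clear hf. elim: gs w hw => [|g gs IHg] [|a w] //= [ha hw].
  split; [exact: (IH g)|exact: IHg].
- elim: (nth 0 v 0) y => [|k IHk] y /=; first exact: (IH f).
  case=> x hx h. exists x; [exact: IHk|exact: (IH g)].
- case=> h hl. split; first exact: (IH f).
  move=> x lt. have [k hk] := hl x lt. exists k. exact: (IH f).
Qed.

End Relativize.

(** Computations from the diagram of one structure are reused with an oracle that joins two diagrams
    and an isomorphism: each oracle call becomes a program reading the relevant part of the larger
    oracle. *)
Lemma cmp_relativize (I J : Type) (o1 : I -> nat -> nat) (o2 : J -> nat -> nat)
    (pi : J -> I) : cmp1 o2 (fun j n => o1 (pi j) n) ->
  forall m f, cmp o1 m f -> cmp o2 m (fun j => f (pi j)).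
Proof.
move=> [e0 h0] m f [e he].
(* [e0] is controlled only on lists of length one, whereas a substituted oracle call may meet any
   list; the projection extracts the head first. *)
have h0' j v : eval (o2 j) (PComp e0 [:: PProj 0]) v (o1 (pi j) (nth 0 v 0)).
  by exists [:: nth 0 v 0] => //; apply: h0.
exists (subst_oracle (PComp e0 [:: PProj 0]) e) => j v sv.
exact: (eval_subst (h0' j)) (he (pi j) v sv).
Qed.

(** * Power series *)

Local Open Scope ring_scope.

Record pseries (F : fieldType) := PSeries { pcoef :> nat -> F }.

Lemma pseriesP (F : fieldType) (f g : pseries F) : f =1 g -> f = g.
Proof. by case: f g => f [g] /= /funext ->. Qed.

HB.instance Definition _ (F : fieldType) := gen_eqMixin (pseries F).
HB.instance Definition _ (F : fieldType) := gen_choiceMixin (pseries F).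

Section PSeries.
Variable F : fieldType.
Implicit Types f g h : pseries F.

Definition ps_zero : pseries F := PSeries (fun _ => 0).
Definition ps_opp f := PSeries (fun n => - f n).
Definition ps_add f g := PSeries (fun n => f n + g n).
Definition psC (a : F) := PSeries (fun n => if n is 0%N then a else 0).
Definition ps_mul f g := PSeries (fun n => \sum_(j < n.+1) f j * g (n - j)%N).
Definition psX : pseries F := PSeries (fun n => (n == 1%N)%:R).
Definition ps_trunc n f : {poly F} := \poly_(i < n) f i.

(** A coefficient of a product depends only on truncations of the factors, so commutativity and
    associativity are inherited from [{poly F}]. *)
Lemma ps_mulE N n f g : (n < N)%N ->
  ps_mul f g n = (ps_trunc N f * ps_trunc N g)`_n.
Proof.
move=> lt; rewrite coefM; apply: eq_bigr => j _.
by rewrite !coef_poly !(leq_ltn_trans _ lt) ?leq_subr // -ltnS.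
Qed.

Lemma ps_trunc_mul N n f g (p : {poly F}) : (n < N)%N ->
  (ps_trunc N (ps_mul f g) * p)`_n = (ps_trunc N f * ps_trunc N g * p)`_n.
Proof.
move=> lt; rewrite !coefM; apply: eq_bigr => j _; congr (_ * _).
have ltj : (j < N)%N by apply: leq_trans lt; rewrite ltnS -ltnS.
by rewrite coef_poly ltj (ps_mulE _ _ ltj).
Qed.

Lemma ps_addA : associative ps_add.
Proof. by move=> f g h; apply: pseriesP => n /=; rewrite addrA. Qed.
Lemma ps_addC : commutative ps_add.
Proof. by move=> f g; apply: pseriesP => n /=; rewrite addrC. Qed.
Lemma ps_add0 : left_id ps_zero ps_add.
Proof. by move=> f; apply: pseriesP => n /=; rewrite add0r. Qed.
Lemma ps_addN : left_inverse ps_zero ps_opp ps_add.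
Proof. by move=> f; apply: pseriesP => n /=; rewrite addNr. Qed.
HB.instance Definition _ :=
  GRing.isZmodule.Build (pseries F) ps_addA ps_addC ps_add0 ps_addN.

Lemma ps_mulC : commutative ps_mul.
Proof.
by move=> f g; apply: pseriesP => n; rewrite !(ps_mulE _ _ (ltnSn n)) mulrC.
Qed.
Lemma ps_mulA : associative ps_mul.
Proof.
move=> f g h; apply: pseriesP => n; rewrite [in RHS](ps_mulE _ _ (ltnSn n)).
rewrite ps_trunc_mul // ps_mulC (ps_mulE _ _ (ltnSn n)) ps_trunc_mul //.
by congr (polyseq _)`_n; ring.
Qed.
Lemma ps_mul1 : left_id (psC 1) ps_mul.
Proof.
move=> f; apply: pseriesP => n /=; rewrite big_ord_recl /= mul1r subn0.
by rewrite big1 ?addr0 // => i _; rewrite mul0r.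
Qed.
Lemma ps_mulD : left_distributive ps_mul +%R.
Proof.
move=> f g h; apply: pseriesP => n /=; rewrite -big_split /=.
by apply: eq_bigr => j _; rewrite mulrDl.
Qed.
Lemma ps_oneN0 : psC 1 != 0.
Proof. by apply/eqP => /(congr1 (fun f : pseries F => f 0%N)) /= /eqP; rewrite oner_eq0. Qed.
HB.instance Definition _ := GRing.Zmodule_isComNzRing.Build (pseries F)
  ps_mulA ps_mulC ps_mul1 ps_mulD ps_oneN0.

Lemma psD f g n : (f + g) n = f n + g n. Proof. by []. Qed.
Lemma psN f n : (- f) n = - f n. Proof. by []. Qed.
Lemma psB f g n : (f - g) n = f n - g n. Proof. by []. Qed.
Lemma psM f g n : (f * g) n = \sum_(j < n.+1) f j * g (n - j)%N. Proof. by []. Qed.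
Lemma ps0 n : (0 : pseries F) n = 0. Proof. by []. Qed.
Lemma ps1 n : (1 : pseries F) n = (n == 0%N)%:R. Proof. by case: n. Qed.
Lemma psM0 f g : (f * g) 0%N = f 0%N * g 0%N.
Proof. by rewrite psM big_ord1. Qed.
Lemma psXn0 f n : (f ^+ n) 0%N = f 0%N ^+ n.
Proof. by elim: n => [|n IH]; rewrite ?expr0 ?ps1 // !exprS psM0 IH. Qed.

Lemma psC_is_zmod : zmod_morphism psC.
Proof. by move=> a b; apply: pseriesP => -[|n] //=; rewrite subr0. Qed.
Lemma psCM a f n : (psC a * f) n = a * f n.
Proof.
rewrite psM big_ord_recl /= subn0 big1 ?addr0 // => i _; by rewrite mul0r.
Qed.
Lemma psC_is_monoid : monoid_morphism psC.
Proof.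
split=> // a b; apply: pseriesP => n; rewrite psCM.
by case: n => //= n; rewrite mulr0.
Qed.
HB.instance Definition _ := GRing.isZmodMorphism.Build F (pseries F) psC psC_is_zmod.
HB.instance Definition _ := GRing.isMonoidMorphism.Build F (pseries F) psC psC_is_monoid.

Lemma psXM f n : (psX * f) n = if n is m.+1 then f m else 0.
Proof.
rewrite psM big_ord_recl /= mul0r add0r; case: n => [|n]; first by rewrite big_ord0.
by rewrite big_ord_recl /= mul1r subSS subn0 big1 ?addr0 // => i _; rewrite mul0r.
Qed.

Lemma psX_neq0 : psX != 0.
Proof. by apply/eqP => /(congr1 (fun f : pseries F => f 1%N)) /eqP /=; rewrite oner_eq0. Qed.

Lemma psXnM f k n : (psX ^+ k * f) n = if (k <= n)%N then f (n - k)%N else 0.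
Proof.
elim: k n => [|k IH] n; first by rewrite expr0 mul1r subn0.
by rewrite exprS -mulrA psXM; case: n => [|n] //; rewrite IH ltnS subSS.
Qed.

Lemma psXn k n : (psX ^+ k) n = (n == k)%:R.
Proof.
rewrite -[psX ^+ k]mulr1 psXnM ps1; case: leqP => h; last by rewrite ltn_eqF.
by congr ((_ : bool)%:R); lia.
Qed.

Definition ps_shift k f := PSeries (fun n => f (n + k)%N).

Lemma ps_shiftP k f : (forall i, (i < k)%N -> f i = 0) -> f = psX ^+ k * ps_shift k f.
Proof.
move=> h; apply: pseriesP => n; rewrite psXnM /=; case: leqP => hk; last exact: h.
by rewrite subnK.
Qed.

Lemma ps_decomp f : f = psC (f 0%N) + psX * ps_shift 1 f.
Proof.
by apply: pseriesP => -[|n]; rewrite psD psXM /= ?addr0 // add0r addn1.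
Qed.

Lemma ps_order f : f != 0 ->
  exists k g, f = psX ^+ k * g /\ g 0%N != 0.
Proof.
move=> f0; have ex : exists n, f n != 0.
  apply: contrapT => /forallNP h; case/eqP: f0; apply: pseriesP => n.
  by apply/eqP/negPn/negP; apply: h.
exists (ex_minn ex), (ps_shift (ex_minn ex) f); case: ex_minnP => k fk hk.
split=> //; apply: ps_shiftP => i lt; apply/eqP/negPn/negP => /hk.
by rewrite leqNgt lt.
Qed.

Lemma ps_idomain f g : f * g = 0 -> (f == 0) || (g == 0).
Proof.
move=> fg; apply/orP; case: (eqVneq f 0) => [|f0]; first by left.
case: (eqVneq g 0) => [|g0]; first by right.
have [k [f' [Ef f'0]]] := ps_order f0; have [l [g' [Eg g'0]]] := ps_order g0.
have /(congr1 (fun h : pseries F => h (k + l)%N)) := fg.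
rewrite Ef Eg mulrACA -exprD psXnM leqnn subnn psM0 ps0 => /eqP.
by rewrite mulf_eq0 (negPf f'0) (negPf g'0).
Qed.

Lemma ps_unitP f : f 0%N != 0 -> exists g, g * f = 1.
Proof.
move=> f0.
pose u := psC (f 0%N)^-1 * f.
suff [g gE] : exists g, g * u = 1.
  by exists (g * psC (f 0%N)^-1); rewrite -mulrA.
have u0 : u 0%N = 1 by rewrite psCM mulVf.
pose h := ps_shift 1 u; have uE : u = 1 + psX * h by rewrite {1}(ps_decomp u) u0.
(* the geometric series 1 / (1 + z h), coefficient by coefficient *)
pose g := PSeries (fun n => (\sum_(k < n.+1) (- (psX * h)) ^+ k) n).
have gN n N : (n <= N)%N -> (\sum_(k < N.+1) (- (psX * h)) ^+ k) n = g n.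
  elim: N => [|N IH]; first by rewrite leqn0 => /eqP ->.
  rewrite leq_eqVlt => /orP[/eqP -> //|]; rewrite ltnS => le.
  rewrite big_ord_recr psD IH // -mulrN exprMn psXnM ltnNge le /=.
  by rewrite addr0.
exists g; apply: pseriesP => n.
transitivity (((\sum_(k < n.+1) (- (psX * h)) ^+ k) * u) n).
  rewrite !psM; apply: eq_bigr => j _; congr (_ * _).
  by rewrite gN // -ltnS.
have -> : u = 1 - - (psX * h) by rewrite opprK.
rewrite mulrC -opprB mulNr -subrX1 opprB psB -mulrN exprMn psXnM ltnn subr0.
by [].
Qed.

Lemma psX_sqr_coef x n : (psX * x ^+ 2) n = \sum_(j < n) x j * x (n.-1 - j)%N.
Proof. by rewrite psXM expr2; case: n => [|n]; rewrite ?big_ord0. Qed.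

(** In x = t + z x^2 the coefficient of z^m on the right involves only coefficients of x below m.
    The equation is therefore a recursion with a unique solution, and the table makes it
    structural. *)
Fixpoint xi_table (t : pseries F) n : seq F :=
  if n is m.+1 then
    let s := xi_table t m in
    rcons s (t m + \sum_(j < m) s`_j * s`_(m.-1 - j))
  else [::].

Definition xi t : pseries F := PSeries (fun n => (xi_table t n.+1)`_n).

Lemma size_xi_table t n : size (xi_table t n) = n.
Proof. by elim: n => //= n IH; rewrite size_rcons IH. Qed.

Lemma xi_table_nth t n i : (i < n)%N -> (xi_table t n)`_i = xi t i.
Proof.
elim: n => // n IH; rewrite ltnS leq_eqVlt => /orP[/eqP -> //|lt].
by rewrite /= nth_rcons size_xi_table lt IH.
Qed.

Lemma xi_coef t n : xi t n = t n + \sum_(j < n) xi t j * xi t (n.-1 - j)%N.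
Proof.
rewrite {1}/xi /= nth_rcons size_xi_table ltnn eqxx; congr (_ + _).
apply: eq_bigr => j _; rewrite !xi_table_nth //.
by case: n j => [[]//|n j]; rewrite /= ltnS leq_subr.
Qed.

Lemma xiE t : xi t = t + psX * xi t ^+ 2.
Proof. by apply: pseriesP => n; rewrite psD psX_sqr_coef xi_coef. Qed.

Lemma xi_unique t x : x = t + psX * x ^+ 2 -> x = xi t.
Proof.
move=> xE; apply: pseriesP; elim/ltn_ind => n IH.
rewrite xi_coef [in LHS]xE psD psX_sqr_coef; congr (_ + _).
apply: eq_bigr => j _; rewrite !IH //.
by case: n j {IH} => [[]//|n j]; rewrite /= ltnS leq_subr.
Qed.

Lemma xi_sqr t : (1 - psX * xi t *+ 2) ^+ 2 = 1 - psX * t *+ 4.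
Proof.
move: (xi t) (xiE t) => x xE.
have -> : t = x - psX * x ^+ 2 by rewrite {1}xE addrK.
ring.
Qed.

Definition ps_poly (p : {poly F}) : pseries F := PSeries (fun n => p`_n).

Lemma ps_poly_is_zmod : zmod_morphism ps_poly.
Proof. by move=> p q; apply: pseriesP => n /=; rewrite coefB. Qed.
Lemma ps_poly_is_monoid : monoid_morphism ps_poly.
Proof.
split=> [|p q]; apply: pseriesP => n; last by rewrite /= coefM.
by rewrite /= coefC; case: n.
Qed.
HB.instance Definition _ :=
  GRing.isZmodMorphism.Build {poly F} (pseries F) ps_poly ps_poly_is_zmod.
HB.instance Definition _ :=
  GRing.isMonoidMorphism.Build {poly F} (pseries F) ps_poly ps_poly_is_monoid.

Lemma ps_poly_inj : injective ps_poly.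
Proof. by move=> p q pq; apply/polyP => i; apply: (congr1 (@pcoef F ^~ i) pq). Qed.

End PSeries.

Section PSeriesDomain.
Variable F : fieldType.
Implicit Types f g : pseries F.

Definition ps_unit : {pred pseries F} := fun f => f 0%N != 0.

Definition ps_inv f : pseries F :=
  match @idP (f 0%N != 0) with
  | ReflectT f0 => projT1 (cid (ps_unitP f0))
  | ReflectF _ => f
  end.

Lemma ps_mulVx : {in ps_unit, left_inverse 1 ps_inv *%R}.
Proof. by move=> f f0; rewrite /ps_inv; case: {-}_ / idP => // H; case: cid. Qed.

Lemma ps_unitPl f g : g * f = 1 -> ps_unit f.
Proof.
move=> gf; apply/negP => /eqP f0; have /eqP := congr1 (@pcoef F ^~ 0%N) gf.
by rewrite psM0 f0 mulr0 ps1 eq_sym oner_eq0.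
Qed.

Lemma ps_inv_out : {in [predC ps_unit], ps_inv =1 id}.
Proof. by move=> f f0; rewrite /ps_inv; case: {-}_ / idP => // H; case/negP: f0. Qed.

HB.instance Definition _ := GRing.ComNzRing_hasMulInverse.Build (pseries F)
  ps_mulVx ps_unitPl ps_inv_out.
HB.instance Definition _ := GRing.ComUnitRing_isIntegral.Build (pseries F)
  (@ps_idomain F).

End PSeriesDomain.

(** * Bounding the order of vanishing by eigenvalues *)

Section ZeroBound.
Variable F : fieldType.
Implicit Types (f g : pseries F) (P Q : {poly {poly F}}).

(** In F[z][X] the outer variable X stands for the eigenvalue; the bound concerns the inner variable
    z. *)
Definition zdeg k Q := forall i, (size (Q`_i)%R <= k.+1)%N.

Lemma zdegD k P Q : zdeg k P -> zdeg k Q -> zdeg k (P + Q).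
Proof.
move=> hP hQ i; rewrite coefD (leq_trans (size_polyD _ _)) // geq_max.
by rewrite hP hQ.
Qed.

Lemma zdeg_sum k (I : finType) (P : I -> {poly {poly F}}) :
  (forall i, zdeg k (P i)) -> zdeg k (\sum_i P i).
Proof.
move=> h; elim/big_ind: _ => [i||//]; first by rewrite coef0 size_poly0.
exact: zdegD.
Qed.

Lemma zdegM k l P Q : zdeg k P -> zdeg l Q -> zdeg (k + l) (P * Q).
Proof.
move=> hP hQ i; rewrite coefM; apply: leq_trans (size_sum _ _ _) _.
apply/bigmax_leqP => j _; apply: leq_trans (size_polyMleq _ _) _.
by have := hP j; have := hQ (i - j)%N; lia.
Qed.

Lemma zdeg1 k : zdeg k 1.
Proof. by move=> i; rewrite coefC; case: eqP; rewrite ?size_poly1 ?size_poly0. Qed.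

Lemma zdegN k P : zdeg k P -> zdeg k (- P).
Proof. by move=> h i; rewrite coefN size_polyN. Qed.

Lemma zdeg_prod k (I : finType) (P : I -> {poly {poly F}}) :
  (forall i, zdeg k (P i)) -> zdeg (k * #|I|) (\prod_i P i).
Proof.
move=> h; rewrite -sum1_card big_distrr /= muln1.
elim/big_ind2: _ => [|m P1 l P2|//]; [exact: zdeg1 | exact: zdegM].
Qed.

Lemma zdeg_det k n (A : 'M[{poly {poly F}}]_n) :
  (forall i j, zdeg k (A i j)) -> zdeg (k * n) (\det A).
Proof.
move=> h; apply: zdeg_sum => s; set p := \prod_i _.
have hp : zdeg (k * n) p.
  by rewrite -{1}[n]card_ord; apply: zdeg_prod.
by case: (perm.odd_perm s); rewrite ?expr0 ?mul1r // expr1 mulN1r; apply: zdegN.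
Qed.

(** Powers of X can be divided out because [f] is nonzero, so the constant coefficient [c] may be
    assumed nonzero. Then [c] is a multiple of [f]; if [f] vanished through index [k], so would [c],
    whose degree is at most [k]. *)
Lemma zdeg_root k Q f : zdeg k Q -> Q != 0 -> f != 0 ->
  (map_poly (@ps_poly F) Q).[f] = 0 -> exists2 n, (n <= k)%N & f n != 0.
Proof.
elim/poly_ind: Q => [|Q c IH]; first by rewrite eqxx.
move=> hQ Q0 f0; rewrite rmorphD rmorphM /= map_polyX map_polyC /= hornerMXaddC.
have [c0|c0] := eqVneq c 0.
  rewrite c0 raddf0 addr0 => /eqP; rewrite mulf_eq0 (negPf f0) orbF => /eqP.
  apply: IH => // [i|]; first by have := hQ i.+1; rewrite coefD coefMX coefC addr0.
  by apply: contra_neq Q0 => ->; rewrite mul0r c0 add0r.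
move=> E; apply: contrapT => /forall2NP h.
case/eqP: c0; apply: (@ps_poly_inj F); rewrite raddf0; apply: pseriesP => n.
have sc : (size c <= k.+1)%N by have := hQ 0%N; rewrite coefD coefMX coefC add0r.
case: (ltnP k n) => hn; first by rewrite /= nth_default // (leq_trans sc).
move/addr0_eq: E => <-.
rewrite psN psM big1 ?oppr0 // => j _.
case: (h (n - j)%N) => [|/negP/negPn/eqP ->]; last by rewrite mulr0.
by case; rewrite (leq_trans (leq_subr _ _)).
Qed.

(* [psX ^+ h * f] is an eigenvalue of a matrix of size at most [d] whose entries
   are polynomials of degree at most [2 h]. *)
Definition eigen h d f :=
  exists (I : finType) (w : I -> pseries F) (M : I -> I -> {poly F}),
    [/\ (#|I| <= d)%N, exists i, w i != 0, forall i j, (size (M i j) <= h.*2.+1)%N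
      & forall i, psX F ^+ h * f * w i = \sum_j ps_poly (M i j) * w j].

(** Multiplying by the adjugate shows that det(T - A), for T = z^h f, annihilates the nonzero vector
    [w], so T is a root of the characteristic polynomial of [A]. Its coefficients have degree at
    most [h.*2 * #|I|] in z, which bounds the order of T and hence of [f]. *)
Lemma eigen_bound h d f : eigen h d f -> f != 0 ->
  exists2 n, (n <= h.*2 * d)%N & f n != 0.
Proof.
case=> I [w [M [cI [i0 wi0] sM Mw]]] f0; pose T := psX F ^+ h * f.
pose A : 'M[{poly F}]_#|I| := \matrix_(i, j) M (enum_val i) (enum_val j).
have dQ : zdeg (h.*2 * #|I|) (char_poly A).
  apply: zdeg_det => i j k; rewrite !mxE coefB coefC coefMn coefX.
  rewrite (leq_trans (size_polyD _ _)) // geq_max size_polyN.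
  apply/andP; split; last by case: eqP => _; rewrite ?sM ?size_poly0.
  case: (i == j); case: (k == 1%N); rewrite ?mulr1n ?mulr0n ?size_poly0 //.
  by rewrite size_poly1.
have T0 : T != 0 by rewrite mulf_neq0 // expf_neq0 // psX_neq0.
have [||n le Tn] := zdeg_root dQ _ T0; first by rewrite monic_neq0 ?char_poly_monic.
  pose v : 'cV[pseries F]_#|I| := \col_i w (enum_val i).
  pose B := map_mx (@ps_poly F) A.
  have Bv : (T%:M - B) *m v = 0.
    rewrite mulmxBl mul_scalar_mx; apply/eqP; rewrite subr_eq0; apply/eqP.
    apply/matrixP => i j; rewrite !mxE Mw (reindex (@enum_val I predT)) /=; last first.
      by apply: onW_bij; apply: enum_val_bij.
    by apply: eq_bigr => k _; rewrite !mxE.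
  have : \adj (T%:M - B) *m ((T%:M - B) *m v) = 0 by rewrite Bv mulmx0.
  rewrite mulmxA mul_adj_mx mul_scalar_mx => /matrixP/(_ (enum_rank i0) 0).
  rewrite !mxE enum_rankK => /eqP; rewrite mulf_eq0 (negPf wi0) orbF => /eqP detB.
  rewrite -[RHS]detB map_char_poly /char_poly -/(horner_eval T _) -det_map_mx.
  congr (\det _); apply/matrixP => i j.
  rewrite !mxE /= /horner_eval hornerD hornerN hornerC; congr (_ - _).
  by case: (i == j); rewrite ?mulr1n ?mulr0n ?hornerX ?horner0.
move: Tn; rewrite psXnM; case: leqP => [hn fn|]; last by rewrite eqxx.
exists (n - h)%N => //.
by rewrite (leq_trans (leq_subr _ _)) // (leq_trans le) // leq_mul2l cI orbT.
Qed.

Lemma eigenC h a : eigen h 1 (psC a).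
Proof.
exists unit, (fun=> 1), (fun _ _ => 'X^h * a%:P); split=> [||_ _|_].
- by rewrite card_unit.
- by exists tt; rewrite oner_neq0.
- rewrite mulrC mul_polyC (leq_trans (size_scale_leq _ _)) // size_polyXn; lia.
rewrite big_const card_unit /= addr0; congr (_ * _); rewrite rmorphM rmorphXn /=.
congr (_ ^+ _ * _); apply: pseriesP => n /=; first by rewrite coefX.
by rewrite coefC; case: n.
Qed.

(** The entry z^2 at h = 1 is the origin of the degree bound 2 h; the other constructions would also
    preserve the bound h. *)
Lemma eigenX : eigen 1 1 (psX F).
Proof.
exists unit, (fun=> 1), (fun _ _ => 'X^2); split=> [||_ _|_].
- by rewrite card_unit.
- by exists tt; rewrite oner_neq0.
- by rewrite size_polyXn.
rewrite big_const card_unit /= addr0 expr1 -expr2; congr (_ * _).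
by apply: pseriesP => n; rewrite psXn /= coefXn.
Qed.

Lemma ps_polyXn k : ps_poly 'X^k = psX F ^+ k.
Proof. by apply: pseriesP => n; rewrite psXn /= coefXn. Qed.

Lemma sum_delta (I : finType) (i : I) (w : I -> pseries F) :
  \sum_j (i == j)%:R * w j = w i.
Proof.
rewrite (bigD1 i) //= eqxx mul1r big1 ?addr0 // => j ne.
by rewrite eq_sym (negPf ne) mul0r.
Qed.

Lemma sum_pair (I J : finType) (a : I -> pseries F) (b : J -> pseries F) :
  \sum_(q : I * J) a q.1 * b q.2 = (\sum_i a i) * (\sum_j b j).
Proof. by rewrite big_distrlr /= pair_bigA. Qed.

(** The tensor product of the eigenvectors is an eigenvector of the Kronecker product of the
    matrices. *)
Lemma eigenM h1 h2 d1 d2 f1 f2 : eigen h1 d1 f1 -> eigen h2 d2 f2 ->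
  eigen (h1 + h2) (d1 * d2) (f1 * f2).
Proof.
case=> I1 [w1 [M1 [c1 [i1 n1] s1 e1]]] [I2 [w2 [M2 [c2 [i2 n2] s2 e2]]]].
exists (I1 * I2)%type, (fun p => w1 p.1 * w2 p.2),
  (fun p q => M1 p.1 q.1 * M2 p.2 q.2); split=> [||p q|p].
- by rewrite card_prod leq_mul.
- by exists (i1, i2); rewrite mulf_neq0.
- apply: leq_trans (size_polyMleq _ _) _.
  by have := s1 p.1 q.1; have := s2 p.2 q.2; lia.
rewrite exprD (_ : _ * _ = (psX F ^+ h1 * f1 * w1 p.1) * (psX F ^+ h2 * f2 * w2 p.2));
  last by ring.
rewrite e1 e2 -sum_pair; apply: eq_bigr => q _; rewrite rmorphM /=; ring.
Qed.

(** The same tensor product is an eigenvector of the Kronecker sum; the factors z^h2 and z^h1 bring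
    both summands to the common scale z^(h1 + h2). *)
Lemma eigenD h1 h2 d1 d2 f1 f2 : eigen h1 d1 f1 -> eigen h2 d2 f2 ->
  eigen (h1 + h2) (d1 * d2) (f1 + f2).
Proof.
case=> I1 [w1 [M1 [c1 [i1 n1] s1 e1]]] [I2 [w2 [M2 [c2 [i2 n2] s2 e2]]]].
exists (I1 * I2)%type, (fun p => w1 p.1 * w2 p.2),
  (fun p q => 'X^h2 * M1 p.1 q.1 * (p.2 == q.2)%:R
            + 'X^h1 * M2 p.2 q.2 * (p.1 == q.1)%:R); split=> [||p q|p].
- by rewrite card_prod leq_mul.
- by exists (i1, i2); rewrite mulf_neq0.
- have sX (k l : nat) (P : {poly F}) (b : bool) : (size P <= l.*2.+1)%N ->
      (size ('X^k * P * b%:R)%R <= (k + l).*2.+1)%N.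
    move=> sP; case: b; rewrite ?mulr0 ?size_poly0 // mulr1.
    by apply: leq_trans (size_polyMleq _ _) _; rewrite size_polyXn; lia.
  rewrite (leq_trans (size_polyD _ _)) // geq_max.
  by rewrite {1}[(h1 + h2)%N]addnC !sX.
rewrite exprD (_ : _ * _ = psX F ^+ h2 * ((psX F ^+ h1 * f1 * w1 p.1) * w2 p.2)
   + psX F ^+ h1 * (w1 p.1 * (psX F ^+ h2 * f2 * w2 p.2))); last by ring.
rewrite e1 e2 -{1}[w2 p.2]sum_delta -[in X in _ + X](sum_delta p.1 w1).
rewrite -!sum_pair !mulr_sumr -big_split /=; apply: eq_bigr => q _.
rewrite rmorphD !rmorphM /= !ps_polyXn !rmorph_nat; ring.
Qed.

(** For u = z xi(f) the equation of xi reads u^2 = u - z f. Hence multiplication by z^h u = z^(h+1)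
    xi(f) maps the span of the [w i] and the [u * w i] to itself: it sends [w i] to z^h times
    [u * w i], and [u * w i] to z^h times [u * w i] minus z times the combination of the [w j] given
    by [M]. The boolean marks the vectors multiplied by u. *)
Lemma eigen_xi h d f : eigen h d f -> eigen h.+1 d.*2 (xi f).
Proof.
case=> I [w [M [cI [i0 n0] sM e]]]; pose u := psX F * xi f.
exists (I * bool)%type, (fun p => if p.2 then u * w p.1 else w p.1),
  (fun p q => 'X^h * (q.2 && (p.1 == q.1))%:R - 'X * M p.1 q.1 * (p.2 && ~~ q.2)%:R).
split=> [||p q|[i b]].
- by rewrite card_prod card_bool muln2 leq_double.
- by exists (i0, false).
- rewrite (leq_trans (size_polyD _ _)) // geq_max size_polyN; apply/andP; split.
    case: (_ && _); rewrite ?mulr0 ?size_poly0 // mulr1 size_polyXn; lia.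
  case: (_ && _); rewrite ?mulr0 ?size_poly0 // mulr1.
  apply: leq_trans (size_polyMleq _ _) _; rewrite size_polyX.
  by rewrite add2n /= doubleS -(addn2 h.*2) ltnS addn2 (leq_trans (sM _ _)) // leqnSn.
rewrite -(pair_bigA _ (fun j c => ps_poly ('X^h * (c && (i == j))%:R
    - 'X * M i j * (b && ~~ c)%:R) * (if c then u * w j else w j))) /=.
have -> : psX F ^+ h.+1 * xi f = psX F ^+ h * u by rewrite exprSr mulrA.
have uE : u = psX F * f + u ^+ 2.
  by rewrite {1}/u {1}xiE mulrDr exprMn expr2 mulrA.
transitivity (\sum_j ((i == j)%:R * (psX F ^+ h * (u * w j))
   - b%:R * psX F * (ps_poly (M i j) * w j))); last first.
  apply: eq_bigr => j _; rewrite big_bool /= !rmorphB !rmorphM /= !ps_polyXn.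
  rewrite -[ps_poly 'X]/(ps_poly 'X^1) ps_polyXn !rmorph_nat andbF andbT /=; ring.
rewrite big_split /= sumrN -mulr_sumr -e sum_delta.
case: b; rewrite /= ?mul1r; last by rewrite !mul0r subr0 mulrA.
rewrite (_ : psX F ^+ h * u * (u * w i) = psX F ^+ h * w i * (u ^+ 2)); last by ring.
rewrite (_ : u ^+ 2 = u - psX F * f); last by rewrite [in RHS]uE; ring.
ring.
Qed.

End ZeroBound.

Section Eval.
Variables (F : fieldType) (phi : nat -> F).

(* A product whose left factor is syntactically [One] encodes [xi]. *)
Fixpoint peval (t : term) : pseries F :=
  match t with
  | Zero => 0
  | One => psX F
  | Par a => psC (phi a)
  | Add s t => peval s + peval t
  | Mul One t => xi (peval t)
  | Mul s t => peval s * peval t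
  end.

Fixpoint ones (t : term) : nat :=
  match t with
  | One => 1
  | Add s t | Mul s t => ones s + ones t
  | _ => 0
  end.

(** Each [One] either names z or marks an application of xi, so counting them accounts for the
    powers of z and for the doublings of the matrix alike. *)
Lemma eigen_peval t : eigen (ones t) (2 ^ ones t) (peval t).
Proof.
elim: t => [||a|s IHs t IHt|s IHs t IHt] /=.
- by rewrite -[0](raddf0 (@psC F)); apply: eigenC.
(* Size one is enough for z; the weaker bound 2 allows one formula for both roles of [One]. *)
- have [I [w [M [cI w0 sM e]]]] := eigenX F.
  by exists I, w, M; split=> //; apply: leq_trans cI _.
- exact: eigenC.
- by rewrite expnD; apply: eigenD.
- case: s IHs => [||a|s1 s2|s1 s2] IHs; try by rewrite expnD; apply: eigenM.
  by rewrite add1n expnS mul2n; apply: eigen_xi.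
Qed.

End Eval.

(** * The field attached to F *)

Lemma subf_div (E : fieldType) (a b c d : E) : b != 0 -> d != 0 ->
  a / b - c / d = (a * d - c * b) / (b * d).
Proof. by move=> b0 d0; rewrite -mulNr addf_div // mulNr. Qed.

Section Subfield.
Variable E : fieldType.

Definition subfield_closed (S : E -> Prop) :=
  [/\ S 1, forall x y, S x -> S y -> S (x - y) & forall x y, S x -> S y -> S (x / y)].

Variables (S : E -> Prop) (hS : subfield_closed S).

(** Indexing the predicate by the closure proof lets the algebraic structure be declared once for
    every Prop-valued [S]. *)
Definition in_subfield (_ : subfield_closed S) : {pred E} := fun x => `[< S x >].

Lemma in_subfield_closed : divring_closed (in_subfield hS).
Proof.
case: hS => S1 SB SV; split=> [|x y /asboolP Sx /asboolP Sy|x y /asboolP Sx /asboolP Sy];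
  apply/asboolP; by [|apply: SB|apply: SV].
Qed.
HB.instance Definition _ := GRing.isDivringClosed.Build E (in_subfield hS)
  in_subfield_closed.

Record subfield (h : subfield_closed S) :=
  Subfield { sfval : E; _ : sfval \in in_subfield h }.

End Subfield.

HB.instance Definition _ E S hS := [isSub for (@sfval E S hS)].
HB.instance Definition _ E S hS := [Choice of (@subfield E S hS) by <:].
HB.instance Definition _ E S hS :=
  [SubChoice_isSubIntegralDomain of (@subfield E S hS) by <:].
HB.instance Definition _ E S hS :=
  [SubIntegralDomain_isSubField of (@subfield E S hS) by <:].

Section SubfieldTheory.
Variables (E : fieldType) (S : E -> Prop) (hS : subfield_closed S).

Lemma sfvalP (x : subfield hS) : S (sfval x).
Proof. by case: x => x /= /asboolP. Qed.

Lemma sfval_ex (y : E) : S y -> exists x : subfield hS, sfval x = y.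
Proof. by move=> Sy; exists (Subfield (introT (asboolP (S y)) Sy : y \in in_subfield hS)). Qed.

Lemma sfval_is_zmod : zmod_morphism (@sfval E S hS).
Proof. exact: (rmorphB (\val : subfield hS -> E)). Qed.
Lemma sfval_is_monoid : monoid_morphism (@sfval E S hS).
Proof. exact: (rmorph1 (\val : subfield hS -> E), rmorphM (\val : subfield hS -> E)). Qed.
HB.instance Definition _ :=
  GRing.isZmodMorphism.Build (subfield hS) E (@sfval E S hS) sfval_is_zmod.
HB.instance Definition _ :=
  GRing.isMonoidMorphism.Build (subfield hS) E (@sfval E S hS) sfval_is_monoid.

Lemma sfval_inj : injective (@sfval E S hS).
Proof. exact: fmorph_inj. Qed.

Lemma sfval_eq0 (x : subfield hS) : (sfval x == 0) = (x == 0).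
Proof. exact: fmorph_eq0. Qed.

End SubfieldTheory.

Section ClosedRing.
Variable F : fieldType.
Implicit Types f g h : pseries F.

Inductive inR : pseries F -> Prop :=
| inR_C a : inR (psC a)
| inR_X : inR (psX F)
| inR_D f g of inR f & inR g : inR (f + g)
| inR_M f g of inR f & inR g : inR (f * g)
| inR_xi f of inR f : inR (xi f).

Lemma inR0 : inR 0. Proof. by rewrite -(raddf0 (@psC F)); apply: inR_C. Qed.
Lemma inR1 : inR 1. Proof. exact: inR_C. Qed.
Lemma inR_N f : inR f -> inR (- f).
Proof.
move=> hf; rewrite -mulN1r; apply: inR_M => //.
by rewrite -(rmorphN1 (@psC F)); apply: inR_C.
Qed.
Lemma inR_Xn f n : inR f -> inR (f ^+ n).
Proof.
by move=> hf; elim: n => [|n IH]; rewrite ?expr0 ?exprS; [apply: inR1|apply: inR_M].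
Qed.
Lemma inR_Mn f n : inR f -> inR (f *+ n).
Proof.
by move=> hf; elim: n => [|n IH]; rewrite ?mulr0n ?mulrS; [apply: inR0|apply: inR_D].
Qed.

Lemma shiftE f g a : f = psC a + psX F * g -> ps_shift 1 f = g.
Proof.
move=> ->; apply: pseriesP => n; rewrite -[LHS]/((psC a + psX F * g) (n + 1)%N) addn1 psD psXM; apply: add0r.
Qed.

(** For a product this is the Leibniz-like splitting at the constant terms, and for xi it is the
    defining equation itself. The consequence is that a nonzero element of R is a power of z times
    an element of R with nonzero constant term. *)
Lemma inR_shift1 f : inR f -> inR (ps_shift 1 f).
Proof.
elim=> {f} [a||f g hf IHf hg IHg|f g hf IHf hg IHg|f hf IHf].
- by rewrite (@shiftE _ 0 a) ?mulr0 ?addr0 //; apply: inR0.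
- by rewrite (@shiftE _ 1 0) ?raddf0 ?add0r ?mulr1 //; apply: inR1.
- rewrite (@shiftE _ (ps_shift 1 f + ps_shift 1 g) (f 0%N + g 0%N)).
    exact: inR_D.
  by rewrite {1}(ps_decomp f) {1}(ps_decomp g) raddfD /=; ring.
- rewrite (@shiftE _ (ps_shift 1 f * g + psC (f 0%N) * ps_shift 1 g) (f 0%N * g 0%N)).
    by apply: inR_D; apply: inR_M => //; apply: inR_C.
  rewrite {1}(ps_decomp f) mulrDl {1}[in X in X + _](ps_decomp g) rmorphM /=; ring.
- rewrite (@shiftE _ (ps_shift 1 f + xi f ^+ 2) (f 0%N)).
    by apply: inR_D => //; apply: inR_Xn; apply: inR_xi.
  by rewrite {1}xiE {1}(ps_decomp f) mulrDr addrA.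
Qed.

Lemma inR_shift k f : inR f -> inR (ps_shift k f).
Proof.
move=> hf; elim: k => [|k IH].
  by rewrite (_ : ps_shift 0 f = f) //; apply: pseriesP => n; rewrite /= addn0.
rewrite (_ : ps_shift k.+1 f = ps_shift 1 (ps_shift k f)); first exact: inR_shift1.
by apply: pseriesP => n /=; rewrite addn1 addSnnS.
Qed.

Lemma inR_peval (phi : nat -> F) : (forall a, exists n, phi n = a) ->
  forall f, inR f -> exists t, f = peval phi t.
Proof.
move=> hphi f; elim=> {f} [a||f g _ [s ->] _ [t ->]|f g _ [s ->] _ [t ->]|f _ [t ->]].
- by have [n <-] := hphi a; exists (Par n).
- by exists One.
- by exists (Add s t).
(* The summand [Zero] keeps the product from being read as xi when [s] is [One]. *)
- by exists (Mul (Add Zero s) t) => /=; rewrite add0r.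
- by exists (Mul One t).
Qed.

Lemma peval_inR (phi : nat -> F) t : inR (peval phi t).
Proof.
elim: t => [||a|s IHs t IHt|s IHs t IHt] /=.
- exact: inR0.
- exact: inR_X.
- exact: inR_C.
- exact: inR_D.
- by case: s IHs => [||a|s1 s2|s1 s2] IHs; try exact: inR_M; apply: inR_xi.
Qed.

Lemma order_inR f : f != 0 -> inR f ->
  exists k g, [/\ f = psX F ^+ k * g, g 0%N != 0 & inR g].
Proof.
move=> f0 hf; have [k [g [E g0]]] := ps_order f0; exists k, g; split=> //.
rewrite (_ : g = ps_shift k f); first exact: inR_shift.
by apply: pseriesP => n; rewrite E -[RHS]/((psX F ^+ k * g) (n + k)%N) psXnM leq_addl addnK.
Qed.

(** A zero denominator is allowed: by the convention on inverses it only contributes the value 0. *)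
Definition inK (x : {fraction pseries F}) : Prop :=
  exists f g, [/\ inR f, inR g & x = tofrac f / tofrac g].

Lemma inK_closed : subfield_closed inK.
Proof.
split=> [|_ _ [f [g [hf hg ->]]] [f' [g' [hf' hg' ->]]]
         |_ _ [f [g [hf hg ->]]] [f' [g' [hf' hg' ->]]]].
- by exists 1, 1; rewrite tofrac1 divr1; split=> //; apply: inR1.
- have [->|g0] := eqVneq g 0.
    by exists (- f'), g'; rewrite tofrac0 invr0 mulr0 sub0r tofracN mulNr; split=> //; apply: inR_N.
  have [->|g'0] := eqVneq g' 0.
    by exists f, g; rewrite tofrac0 invr0 mulr0 subr0.
  exists (f * g' - f' * g), (g * g'); split; [|exact: inR_M|].
    by apply: inR_D; [|apply: inR_N]; apply: inR_M.
  by rewrite subf_div ?tofrac_eq0 // tofracB !tofracM.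
- exists (f * g'), (g * f'); split; [exact: inR_M|exact: inR_M|].
  by rewrite !tofracM invf_div mulf_div.
Qed.

Definition Kfield := subfield inK_closed.

End ClosedRing.

(** * Recovering F *)

Definition div2 (E : fieldType) (x : E) : Prop :=
  x != 0 /\ forall n, exists y, y ^+ (2 ^ n) = x.

(** If [y] has a pole, then for every nonzero [w] some [w * y ^+ n] has one too, hence so has
    [1 + w * y ^+ n], whose valuation is then not divisible by all powers of 2. For integral [y] the
    witness is w = z. Only field operations occur, so field morphisms preserve the condition. *)
Definition divisibly_bounded (E : fieldType) (y : E) : Prop :=
  exists2 w, w != 0 & forall n, div2 (1 + w * y ^+ n).

Section Invariance.
Variables (E E' : fieldType) (h : {rmorphism E -> E'}).

Lemma div2_morph x : div2 x -> div2 (h x).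
Proof.
case=> x0 hx; split=> [|n]; first by rewrite fmorph_eq0.
by have [y <-] := hx n; exists (h y); rewrite rmorphXn.
Qed.

Lemma divisibly_bounded_morph y : divisibly_bounded y -> divisibly_bounded (h y).
Proof.
case=> w w0 H; exists (h w) => [|n]; first by rewrite fmorph_eq0.
by have := div2_morph (H n); rewrite rmorphD rmorph1 rmorphM rmorphXn.
Qed.

End Invariance.

Section Valuation.
Variable F : fieldType.
Implicit Types (f g u v : pseries F).
Local Notation FF := {fraction pseries F}.
Local Notation K := (Kfield F).
Local Notation "f %:F" := (tofrac f).
Local Notation z := (psX F).

Lemma tofrac_inj : injective (@tofrac (pseries F)).
Proof. by move=> f g /eqP; rewrite tofrac_eq => /eqP. Qed.

Lemma order_unique k l u v : u 0%N != 0 -> v 0%N != 0 ->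
  z ^+ k * u = z ^+ l * v -> k = l.
Proof.
wlog lt : k l u v / (k <= l)%N => [W u0 v0 E|u0 v0 E].
  by case/orP: (leq_total k l) => le; [|apply: esym]; [apply: W E|apply: W (esym E)].
apply/eqP; rewrite eqn_leq lt /= leqNgt; apply/negP => kl.
move/(congr1 (fun f : pseries F => f k)): E; rewrite !psXnM leqnn subnn leqNgt kl /=.
by apply/eqP.
Qed.

(** The valuation of [x] is k - l; two natural exponents avoid negative powers of z. *)
Lemma inK_order (x : FF) : inK x -> x != 0 ->
  exists k l u, u 0%N != 0 /\ x * z%:F ^+ l = z%:F ^+ k * u%:F.
Proof.
case=> f [g [_ _ ->]]; rewrite mulf_eq0 invr_eq0 !tofrac_eq0 negb_or => /andP[f0 g0].
have [k [f' [-> f'0]]] := ps_order f0; have [l [g' [Eg g'0]]] := ps_order g0.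
have [e eg'] := ps_unitP g'0.
have e0 : e 0%N != 0.
  apply: contraTneq isT => e0; have := congr1 (@pcoef F ^~ 0%N) eg'.
  by rewrite psM0 e0 mul0r ps1 => /esym/eqP; rewrite oner_eq0.
exists k, l, (f' * e); split; first by rewrite psM0 mulf_neq0.
apply: (mulIf (x := g%:F)); rewrite ?tofrac_eq0 // mulrAC divfK ?tofrac_eq0 //.
rewrite -!tofracXn -!tofracM; congr (_%:F).
by rewrite Eg -[in LHS](mulr1 f') -eg'; ring.
Qed.

Lemma clear_roots (E : comNzRingType) (X Y a b c d v u : E) n :
  Y ^+ n = X -> Y * b = a * v -> X * c = d * u ->
  a ^+ n * c * v ^+ n = b ^+ n * d * u.
Proof.
by move=> <- yE xE; rewrite mulrAC -exprMn -yE exprMn -[RHS]mulrA -xE; ring.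
Qed.

Lemma clear_power (E : comNzRingType) (W Y a b c d v u : E) n :
  Y * b = a * u -> W * c = d * v -> d * a ^+ n * (v * u ^+ n) = c * b ^+ n * (W * Y ^+ n).
Proof. by move=> yE wE; rewrite mulrACA -exprMn -yE -wE exprMn; ring. Qed.

(** If v(x) = k - l, a root of order N = 2^(k + l) forces N to divide k - l, whereas |k - l| <= k +
    l < N; so v(x) = 0. *)
Lemma div2_integral (x : K) : div2 x -> exists2 u : pseries F, u 0%N != 0 & sfval x = u%:F.
Proof.
case=> x0 roots; have nz (y : K) : y != 0 -> sfval y != 0 by rewrite sfval_eq0.
have [k [l [u [u0 xE]]]] := inK_order (sfvalP x) (nz _ x0).
have [y yx] := roots (k + l)%N.
have y0 : y != 0 by apply: contra_neq x0 => y0; rewrite -yx y0 expr0n expn_eq0.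
have [k' [l' [v [v0 yE]]]] := inK_order (sfvalP y) (nz _ y0).
set N := (2 ^ (k + l))%N in yx; have ltN : (k + l < N)%N by apply: ltn_expl.
have E : z ^+ (k' * N + l) * v ^+ N = z ^+ (l' * N + k) * u.
  apply: tofrac_inj; rewrite !tofracM !tofracXn !exprD !exprM.
  apply: clear_roots yE xE; by rewrite -rmorphXn yx.
have vN0 : (v ^+ N) 0%N != 0 by rewrite psXn0 expf_neq0.
have /esym kl := order_unique vN0 u0 E.
have kl' : k = l.
  have [e|[e|e]] : (k' = l' \/ k' < l' \/ l' < k')%N by lia.
  - by move: kl; rewrite e; lia.
  - have := leq_mul e (leqnn N); rewrite mulSn; lia.
  - have := leq_mul e (leqnn N); rewrite mulSn; lia.
exists u => //; apply: (mulIf (x := z%:F ^+ l)).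
  by rewrite expf_neq0 // tofrac_eq0 psX_neq0.
by rewrite xE kl' mulrC.
Qed.

Lemma bounded_integral (y : K) : divisibly_bounded y -> exists f, sfval y = f%:F.
Proof.
case=> w w0 H; have [->|y0] := eqVneq y 0; first by exists 0; rewrite !rmorph0.
have nz (x : K) : x != 0 -> sfval x != 0 by rewrite sfval_eq0.
have [k [l [u [u0 yE]]]] := inK_order (sfvalP y) (nz _ y0).
have [k' [l' [v [v0 wE]]]] := inK_order (sfvalP w) (nz _ w0).
have hg n : exists g, sfval w * sfval y ^+ n = g%:F.
  have [g _] := div2_integral (H n); rewrite rmorphD rmorph1 rmorphM rmorphXn => gE.
  by exists (g - 1); rewrite tofracB -gE tofrac1 addrC addKr.
have lk : (l <= k)%N.
  (* If k < l, then at n = k' + 1 the valuation k' - l' + n (k - l) of w y^n is negative, although w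
     y^n is a power series. *)
  rewrite leqNgt; apply/negP => kl; have [g gE] := hg k'.+1.
  have E : z ^+ (k' + k * k'.+1) * (v * u ^+ k'.+1) = z ^+ (l' + l * k'.+1) * g.
    apply: tofrac_inj; rewrite !tofracM !tofracXn !exprD !exprM -gE.
    exact: clear_power yE wE.
  have lt : (k' + k * k'.+1 < l' + l * k'.+1)%N.
    have := leq_mul kl (leqnn k'.+1); rewrite mulSn; lia.
  move/(congr1 (fun f : pseries F => f (k' + k * k'.+1)%N)): E.
  rewrite psXnM leqnn subnn psM0 psXn0 psXnM (leqNgt (_ + _)) lt => /eqP.
  by rewrite mulf_eq0 expf_eq0 (negPf u0) (negPf v0).
exists (z ^+ (k - l) * u); apply: (mulIf (x := z%:F ^+ l)).
  by rewrite expf_neq0 // tofrac_eq0 psX_neq0.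
by rewrite yE -!tofracXn -!tofracM mulrAC -exprD subnK.
Qed.

Hypothesis char0 : [pchar F] =i pred0.

Lemma natF_neq0 n : n.+1%:R != 0 :> F.
Proof. by rewrite (proj1 (pcharf0P F) char0). Qed.

(** This is [xi_sqr] at t = - f / 4. The root again lies in 1 + z R, so the step can be iterated. *)
Lemma one_unit_sqrt f : inR f ->
  exists2 g, inR g & (1 + z * g) ^+ 2 = 1 + z * f.
Proof.
move=> hf; pose t := psC (- 4%:R^-1) * f.
have ht : inR t by apply: inR_M => //; apply: inR_C.
exists (- (xi t *+ 2)); first by apply/inR_N/inR_Mn/inR_xi.
rewrite mulrN mulrnAr xi_sqr; congr (_ + _).
rewrite /t -mulrnAr -mulrnAl -rmorphMn /= -mulr_natr mulNr mulVf ?natF_neq0 //.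
by rewrite rmorphN1 mulN1r mulrN opprK.
Qed.

Lemma one_unit_roots f n : inR f ->
  exists2 g, inR g & (1 + z * g) ^+ (2 ^ n) = 1 + z * f.
Proof.
elim: n f => [|n IH] f hf; first by exists f.
have [g hg gE] := one_unit_sqrt hf; have [k hk kE] := IH g hg.
by exists k; rewrite // expnSr exprM kE.
Qed.

Lemma inK_tofrac f : inR f -> inK f%:F.
Proof. by exists f, 1; rewrite tofrac1 divr1; split=> //; apply: inR1. Qed.

Lemma one_unit_neq0 f : 1 + z * f != 0.
Proof.
apply/eqP => /(congr1 (fun h : pseries F => h 0%N))/eqP.
by rewrite psD psXM addr0 ps1 oner_eq0.
Qed.

Lemma one_unit_ratio_div2 f g (x : K) : inR f -> inR g ->
  sfval x = (1 + z * f)%:F / (1 + z * g)%:F -> div2 x.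
Proof.
move=> hf hg xE; split=> [|n].
  rewrite -sfval_eq0 xE mulf_neq0 ?invr_eq0 ?tofrac_eq0 //;
  exact: one_unit_neq0.
have [f' hf' f'E] := one_unit_roots n hf; have [g' hg' g'E] := one_unit_roots n hg.
have hu k : inR k -> inR (1 + z * k).
  by move=> hk; apply: inR_D (inR1 F) _; apply: inR_M (inR_X F) hk.
have [y yE] : exists y : K, sfval y = (1 + z * f')%:F / (1 + z * g')%:F.
  by apply: sfval_ex; exists (1 + z * f'), (1 + z * g'); split=> //; apply: hu.
exists y; apply: sfval_inj; rewrite rmorphXn /= yE xE expr_div_n -!tofracXn.
by rewrite f'E g'E.
Qed.

(* Elements of [K] that are power series have a denominator in [1 + z R]. *)
Lemma integral_ratio x f : inK x -> x = f%:F ->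
  exists p q, [/\ inR p, inR q & x = p%:F / (1 + z * q)%:F].
Proof.
case=> a [b [ha hb xE]] xf.
have [b0|b0] := eqVneq b 0.
  exists 0, 0; rewrite xE b0 !tofrac0 invr0 mulr0 mul0r; split=> //; exact: inR0.
have [k [c [bE c0 hc]]] := order_inR b0 hb.
have aE : a = z ^+ k * (f * c).
  apply: tofrac_inj; rewrite mulrCA -bE tofracM -xf xE divfK ?tofrac_eq0 //.
(* [f] is not known to lie in R, but f c is the shift of [a] by [k], and R is closed under
   shifts. *)
have hfc : inR (f * c).
  rewrite (_ : f * c = ps_shift k a); first exact: inR_shift.
  apply: pseriesP => n.
  by rewrite aE -[RHS]/((z ^+ k * (f * c)) (n + k)%N) psXnM leq_addl addnK.
pose u := psC (c 0%N)^-1.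
exists (u * (f * c)), (u * ps_shift 1 c); split; try by apply: inR_M; [exact: inR_C|].
  by apply: inR_M; [exact: inR_C|exact: inR_shift1].
have -> : 1 + z * (u * ps_shift 1 c) = u * c.
  by rewrite [in RHS](ps_decomp c) mulrDr -rmorphM /= mulVf // rmorph1 mulrCA.
have cF0 : c != 0 by apply: contra_neq c0 => ->.
have u0 : u != 0 by rewrite fmorph_eq0 invr_eq0.
by rewrite xf mulrCA [X in X / _]tofracM mulfK // tofrac_eq0 mulf_neq0.
Qed.

(** With y = p / (1 + z q) one has 1 + z y^n = ((1 + z q)^n + z p^n) / (1 + z q)^n, a quotient of
    two elements of 1 + z R, and both have all the required roots. *)
Lemma integral_bounded (y : K) f : sfval y = f%:F -> divisibly_bounded y.
Proof.
move=> yf; have [p [q [hp hq yE]]] := integral_ratio (sfvalP y) yf.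
have [w wE] : exists w : K, sfval w = z%:F by apply/sfval_ex/inK_tofrac/inR_X.
exists w => [|n].
  by rewrite -sfval_eq0 wE tofrac_eq0 psX_neq0.
have [q' hq' q'E] : exists2 q', inR q' & (1 + z * q) ^+ n = 1 + z * q'.
  elim: n => [|n [q' hq' IH]]; first by exists 0; [exact: inR0|rewrite mulr0 addr0].
  exists (q + q' + z * (q * q')); last by rewrite exprS IH; ring.
  by do !apply: inR_D => //; do !apply: inR_M => //; apply: inR_X.
apply: (@one_unit_ratio_div2 (q' + p ^+ n) q') => //.
  by apply: inR_D => //; apply: inR_Xn.
rewrite rmorphD rmorph1 rmorphM rmorphXn /= yE wE expr_div_n -!tofracXn q'E.
rewrite mulrDr addrA; move: (one_unit_neq0 q'); move: (1 + z * q') => q1 q10.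
by rewrite tofracD tofracM mulrDl divff ?mulrA // tofrac_eq0.
Qed.

End Valuation.

Section Recovery.
Variables (F F' : fieldType).
Hypotheses (char0 : [pchar F] =i pred0) (char0' : [pchar F'] =i pred0).
Variables (th : {rmorphism Kfield F -> Kfield F'}) (ht : {rmorphism Kfield F' -> Kfield F}).
Hypotheses (thK : cancel th ht) (htK : cancel ht th).

Lemma const_ex (E : fieldType) (a : E) :
  exists x : Kfield E, sfval x = tofrac (psC a).
Proof. by apply/sfval_ex/inK_tofrac/inR_C. Qed.

Lemma integral_morph (x : Kfield F) f : sfval x = tofrac f ->
  exists f', sfval (th x) = tofrac f'.
Proof.
move=> xf; apply: bounded_integral; apply: divisibly_bounded_morph.
exact: integral_bounded xf.
Qed.

(** [h] sends [a] to the constant term of the image of the constant series [a], an image that is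
    integral by [integral_morph]. This realizes the map of residue fields without forming quotients;
    a morphism of fields is injective, so surjectivity is what remains. *)
Lemma recover : exists h : {rmorphism F -> F'}, bijective h.
Proof.
pose c a := projT1 (cid (const_ex (a : F))).
have cE a : sfval (c a) = tofrac (psC a) by rewrite /c; case: cid.
pose r a := projT1 (cid (integral_morph (cE a))).
have rE a : sfval (th (c a)) = tofrac (r a) by rewrite /r; case: cid.
pose h a := r a 0%N.
have cB a b : c (a - b) = c a - c b.
  by apply: sfval_inj; rewrite rmorphB /= !cE rmorphB tofracB.
have cM a b : c (a * b) = c a * c b.
  by apply: sfval_inj; rewrite rmorphM /= !cE rmorphM tofracM.
have c1 : c 1 = 1 by apply: sfval_inj; rewrite cE !rmorph1.
have hB : zmod_morphism h.
  move=> a b; rewrite /h -psB; congr (pcoef _ _); apply: tofrac_inj.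
  by rewrite tofracB -!rE cB !rmorphB.
have hM : monoid_morphism h.
  split=> [|a b]; last first.
    rewrite /h -psM0; congr (pcoef _ _); apply: tofrac_inj.
    by rewrite tofracM -!rE cM !rmorphM.
  rewrite /h -[RHS](ps1 F' 0%N); congr (pcoef _ _); apply: tofrac_inj.
  by rewrite -rE c1 !rmorph1.
pose hm1 := GRing.isZmodMorphism.Build F F' h hB.
pose hm2 := GRing.isMonoidMorphism.Build F F' h hM.
pose hh : {rmorphism F -> F'} := HB.pack h hm1 hm2.
exists hh.
(* Pull [a'] back along [ht] and take the constant term of the result. The difference [d] has
   constant term 0, and it must be shown that its image under [th] does too. *)
have surj a' : exists a, h a = a'.
  have [y' y'E] := const_ex a'; pose y := ht y'.
  have [f yf] : exists f, sfval y = tofrac f.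
    apply: bounded_integral; apply: divisibly_bounded_morph.
    exact: (integral_bounded char0' y'E).
  pose d := y - c (f 0%N).
  have dE : sfval d = tofrac (psX F * ps_shift 1 f).
    by rewrite rmorphB /= yf cE -tofracB {1}(ps_decomp f) addrC addKr.
  have [e eE] := integral_morph dE.
  exists (f 0%N).
  have -> : h (f 0%N) = a' - e 0%N.
    rewrite /h -[a']/(psC a' 0%N) -psB; congr (pcoef _ _); apply: tofrac_inj.
    rewrite tofracB -rE -eE -y'E -rmorphB; congr sfval.
    by rewrite /d rmorphB /= /y htK opprB addrCA subrr addr0.
  suff -> : e 0%N = 0 by rewrite subr0.
  (* Otherwise the inverse of [th d] would be integral, hence so would its pullback, the inverse of
     [d]; but [d] has constant term 0. *)
  apply/eqP/negPn/negP => e0.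
  have [e' e'e] := ps_unitP e0.
  have [g gE] : exists g, sfval d^-1 = tofrac g.
    apply: bounded_integral; rewrite -[d^-1]thK; apply: divisibly_bounded_morph.
    apply: (@integral_bounded _ char0' _ e'); rewrite !fmorphV /= eE.
    by rewrite -[LHS]mul1r -tofrac1 -e'e tofracM mulfK // tofrac_eq0; apply: contra_neq e0 => ->.
  have d0 : d != 0.
    apply: contra_neq e0 => d0; have := eE; rewrite d0 !rmorph0 => /esym/eqP.
    by rewrite tofrac_eq0 => /eqP ->.
  have : sfval d * sfval d^-1 = 1 by rewrite -rmorphM divff ?rmorph1.
  rewrite dE gE -tofracM -tofrac1 => /tofrac_inj/(congr1 (@pcoef F ^~ 0%N)).
  by rewrite psM0 psXM mul0r ps1 => /esym/eqP; rewrite oner_eq0.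
exists (fun a' => projT1 (cid (surj a'))) => [a|a'] /=; last by case: cid.
by case: cid => b /= hb; apply: (fmorph_inj hh).
Qed.

End Recovery.

(** * Transcendence degree *)

Section RatEval.
Variables (F : fieldType).
Hypothesis char0 : [pchar F] =i pred0.

Lemma int_eq0_char0 (a : int) : (a%:~R == 0 :> F) = (a == 0).
Proof.
case: a => n; first by rewrite (proj1 (pcharf0P F) char0).
by rewrite NegzE mulrNz oppr_eq0 (proj1 (pcharf0P F) char0).
Qed.

(** [ratr] is defined from the reduced fraction. Evaluating it on an arbitrary fraction a / b turns
    its additivity and multiplicativity into identities between integers. *)
Lemma ratr_frac (q : rat) (a b : int) : b != 0 -> q * b%:~R = a%:~R ->
  ratr q * b%:~R = a%:~R :> F.
Proof.
move=> b0 qE; have d0 : (denq q)%:~R != 0 :> F by rewrite int_eq0_char0 denq_eq0.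
have E : numq q * b = a * denq q.
  apply/eqP; rewrite -(eqr_int rat) !rmorphM /= -qE -{2}[q]divq_num_den.
  by rewrite mulrAC divfK // intr_eq0 denq_eq0.
by rewrite /ratr mulrAC -intrM E intrM mulfK.
Qed.

Lemma ratr_zmod : zmod_morphism (ratr : rat -> F).
Proof.
move=> x y; have dx0 : denq x * denq y != 0 by rewrite mulf_neq0 ?denq_eq0.
have d0 : (denq x * denq y)%:~R != 0 :> F by rewrite int_eq0_char0.
have hx := @ratr_frac x (numq x) (denq x) (denq_neq0 _).
have hy := @ratr_frac y (numq y) (denq y) (denq_neq0 _).
have qx : x * (denq x)%:~R = (numq x)%:~R.
  by rewrite -{1}[x]divq_num_den divfK // intr_eq0 denq_eq0.
have qy : y * (denq y)%:~R = (numq y)%:~R.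
  by rewrite -{1}[y]divq_num_den divfK // intr_eq0 denq_eq0.
apply: (mulIf d0); rewrite (@ratr_frac _ (numq x * denq y - numq y * denq x)) //.
  by rewrite mulrBl !intrB !intrM mulrA (hx qx) mulrCA (hy qy) [in X in _ - X]mulrC.
by rewrite mulrBl intrB !intrM mulrA qx mulrCA qy [in X in _ - X]mulrC.
Qed.

Lemma ratr_monoid : monoid_morphism (ratr : rat -> F).
Proof.
split=> [|x y]; first exact: (ratr_nat F 1).
have dx0 : denq x * denq y != 0 by rewrite mulf_neq0 ?denq_eq0.
have d0 : (denq x * denq y)%:~R != 0 :> F by rewrite int_eq0_char0.
have hx := @ratr_frac x (numq x) (denq x) (denq_neq0 _).
have hy := @ratr_frac y (numq y) (denq y) (denq_neq0 _).
have qx : x * (denq x)%:~R = (numq x)%:~R.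
  by rewrite -{1}[x]divq_num_den divfK // intr_eq0 denq_eq0.
have qy : y * (denq y)%:~R = (numq y)%:~R.
  by rewrite -{1}[y]divq_num_den divfK // intr_eq0 denq_eq0.
apply: (mulIf d0); rewrite (@ratr_frac _ (numq x * numq y)) //.
  by rewrite !intrM mulrACA (hx qx) (hy qy).
by rewrite !intrM mulrACA qx qy.
Qed.

Definition ratr_rmorphism : {rmorphism rat -> F} :=
  let m1 := GRing.isZmodMorphism.Build rat F (ratr : rat -> F) ratr_zmod in
  let m2 := GRing.isMonoidMorphism.Build rat F (ratr : rat -> F) ratr_monoid in
  HB.pack (ratr : rat -> F) m1 m2.

Variables (n : nat) (x : 'I_n -> F).

Lemma rat_evalE p : rat_eval x p = mmap ratr_rmorphism x p. Proof. by []. Qed.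

Lemma in_adjoin_closed : subfield_closed (in_adjoin x).
Proof.
split=> [|y y' [p [q [q0 ->]]] [p' [q' [q'0 ->]]]
         |y y' [p [q [q0 ->]]] [p' [q' [q'0 ->]]]].
- by exists 1, 1; rewrite rat_evalE rmorph1 divr1 oner_neq0.
- exists (p * q' - p' * q), (q * q'); rewrite !rat_evalE rmorphB !rmorphM /=.
  by rewrite mulf_neq0 // subf_div.
- have [p'0|p'0] := eqVneq (rat_eval x p') 0.
    exists 0, 1; rewrite p'0 mul0r invr0 mulr0 !rat_evalE rmorph0 rmorph1.
    by rewrite mul0r oner_neq0.
  exists (p * q'), (q * p'); rewrite !rat_evalE !rmorphM /=.
  by rewrite mulf_neq0 // invf_div mulf_div.
Qed.

End RatEval.

Section Quadratic.
Variables (E : fieldType) (a u y : E).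

Lemma quadratic_root : y = u + a * y ^+ 2 -> root (a *: 'X^2 - 'X + u%:P) y.
Proof.
move=> yE; have uE : u = y - a * y ^+ 2 by rewrite {1}yE addrK.
by apply/rootP; rewrite uE !hornerE /=; ring.
Qed.

Lemma quadratic_neq0 : a *: 'X^2 - 'X + u%:P != 0 :> {poly E}.
Proof.
apply/eqP => /polyP/(_ 1%N)/eqP.
by rewrite !coefE /= mulr0 addr0 sub0r oppr_eq0 oner_eq0.
Qed.

(** Over a field, a root of a nonzero polynomial with integral coefficients is integral even if the
    polynomial is not monic; the coefficient -1 of X keeps this one nonzero when a = 0. *)
Lemma quadratic_integral (B : fieldType) (f : {rmorphism B -> E}) :
  integralOver f a -> integralOver f u -> y = u + a * y ^+ 2 -> integralOver f y.
Proof.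
move=> ia iu yE; apply: (integral_root quadratic_neq0 (quadratic_root yE)).
apply/integral_poly => i; rewrite !coefE; apply: integral_add.
  apply: integral_sub; last by case: eqP => _; [apply: integral1|apply: integral0].
  apply: integral_mul => //.
  by case: eqP => _; [apply: integral1|apply: integral0].
by case: eqP => _ //; apply: integral0.
Qed.

End Quadratic.

Section TrDeg.
Variable F : fieldType.
Hypothesis char0 : [pchar F] =i pred0.
Local Notation K := (Kfield F).

Lemma inK_const (a : F) : inK (tofrac (psC a)).
Proof. exact/inK_tofrac/inR_C. Qed.

Definition constK (a : F) : K :=
  Subfield (introT (asboolP _) (inK_const a) : _ \in in_subfield (inK_closed F)).

Lemma constKE a : sfval (constK a) = tofrac (psC a). Proof. by []. Qed.

Lemma constK_is_zmod : zmod_morphism constK.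
Proof. by move=> a b; apply: sfval_inj; rewrite [RHS]rmorphB /= !rmorphB. Qed.
Lemma constK_is_monoid : monoid_morphism constK.
Proof.
split=> [|a b]; apply: sfval_inj; first by rewrite constKE !rmorph1.
by rewrite [RHS]rmorphM /= !rmorphM.
Qed.
HB.instance Definition _ := GRing.isZmodMorphism.Build F K constK constK_is_zmod.
HB.instance Definition _ := GRing.isMonoidMorphism.Build F K constK constK_is_monoid.

Definition varK : K :=
  Subfield (introT (asboolP _) (inK_tofrac (inR_X F)) : _ \in in_subfield (inK_closed F)).

Lemma pchar_Kfield : [pchar K] =i pred0.
Proof.
move=> p; rewrite -char0 !inE; congr (_ && _).
by rewrite -(rmorph_nat constK) fmorph_eq0.
Qed.

Section Basis.
Variables (r : nat) (x : 'I_r -> F).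

(** z comes last because [muni] treats a polynomial as univariate in its last variable. *)
Definition extend_basis (i : 'I_r.+1) : K :=
  if insub (val i) is Some j then constK (x j) else varK.

Lemma extend_basis_widen (j : 'I_r) :
  extend_basis (widen_ord (leqnSn r) j) = constK (x j).
Proof. by rewrite /extend_basis /= valK. Qed.

Lemma extend_basis_max : extend_basis ord_max = varK.
Proof. by rewrite /extend_basis insubN //= ltnn. Qed.

(** A monomial is determined by its last exponent and its restriction to the other variables, so
    each coefficient of [p] reappears as a coefficient of [muni p]. *)
Lemma muni_eq0 (p : {mpoly rat[r.+1]}) : muni p = 0 -> p = 0.
Proof.
move=> p0; apply/mpolyP => m; rewrite mcoeff0.
pose rs (m : 'X_{1..r.+1}) : 'X_{1..r} := [multinom m (widen_ord (leqnSn r) i) | i < r].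
have : ((muni p)`_(m ord_max))@_(rs m) = 0 by rewrite p0 coef0 mcoeff0.
rewrite muniE coef_sum raddf_sum /=.
rewrite (eq_bigr (fun m' => p@_m' * (m' == m)%:R)) => [|m' _].
  have [mp|mp] := boolP (m \in msupp p).
    rewrite (bigD1_seq m) ?msupp_uniq //= eqxx mulr1 big1 ?addr0 // => m' ne.
    by rewrite (negPf ne) mulr0.
  by rewrite memN_msupp_eq0.
rewrite coefZ coefXn; have [e|ne] := eqVneq (m ord_max) (m' ord_max); last first.
  rewrite mulr0 mcoeff0; have [mm'|] := eqVneq m' m; last by rewrite mulr0.
  by rewrite mm' eqxx in ne.
rewrite mulr1 mcoeffZ mcoeffX; congr (_ * (_ : bool)%:R).
apply/eqP/eqP => [h|->]; last by apply/mnmP => i; rewrite !mnmE.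
apply/mnmP => i; have [lt|] := ltnP i r.
  have -> : i = widen_ord (leqnSn r) (Ordinal lt) by apply: val_inj.
  by have /mnmP/(_ (Ordinal lt)) := h; rewrite !mnmE.
move=> ge; have -> : i = ord_max; last by [].
by apply: val_inj => /=; apply/eqP; rewrite eqn_leq ge -ltnS ltn_ord.
Qed.

(** Computed in F[[z]], the coefficient of z^k in p(x, z) is the value at [x] of the k-th
    coefficient of [muni p], to which the independence of [x] applies. *)
Lemma extend_basis_independent : alg_independent x -> alg_independent extend_basis.
Proof.
move=> indep p p0; apply: muni_eq0.
apply/polyP => k; rewrite coef0; apply: indep.
pose xs (i : 'I_r.+1) : pseries F :=
  if insub (val i) is Some j then psC (x j) else psX F.
have xsE i : sfval (extend_basis i) = tofrac (xs i).
  by rewrite /extend_basis /xs; case: insub.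
pose S : pseries F := \sum_(m <- msupp p) psC (ratr p@_m) * \prod_i xs i ^+ m i.
have S0 : S = 0.
  apply: tofrac_inj; rewrite tofrac0 -(rmorph0 (@sfval _ _ (inK_closed F))) -p0.
  rewrite /rat_eval /mmap !rmorph_sum; apply: eq_bigr => m _.
  rewrite [LHS]rmorphM [RHS]rmorphM /mmap1 !rmorph_prod; congr (_ * _).
    transitivity (ratr p@_m : {fraction pseries F}).
      by have := fmorph_rat (@tofrac (pseries F) \o @psC F) p@_m.
    by have := fmorph_rat (@sfval _ _ (inK_closed F)) p@_m.
  by apply: eq_bigr => i _; rewrite !rmorphXn /= xsE.
have := congr1 (@pcoef F ^~ k) S0; rewrite ps0 => Sk.
rewrite -[RHS]Sk /S muniE coef_sum (rat_evalE char0) rmorph_sum.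
rewrite (big_morph (fun f : pseries F => f k) (fun f g => psD f g k) (ps0 F k)).
apply: eq_bigr => m _; rewrite coefZ coefXn psCM big_ord_recr.
have -> : xs ord_max = psX F by rewrite /xs insubN //= ltnn.
rewrite [X in pcoef X]mulrC psXnM.
have -> : \prod_(i < r) xs (widen_ord (leqnSn r) i) ^+ m (widen_ord (leqnSn r) i)
   = psC (\prod_(i < r) x i ^+ m (widen_ord (leqnSn r) i)).
  rewrite rmorph_prod /=; apply: eq_bigr => i _; rewrite rmorphXn /=; congr (_ ^+ _).
  by rewrite /xs /= valK.
case: leqP => h; last by rewrite ltn_eqF // mulr0 rmorph0 mulr0.
have [e|ne] := eqVneq k (m ord_max); last first.
  rewrite mulr0 rmorph0; have : (0 < k - m ord_max)%N by rewrite subn_gt0 ltn_neqAle eq_sym ne.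
  by case: (k - m ord_max)%N => //= j _; rewrite mulr0.
rewrite e subnn mulr1 [LHS](mmapZ x (ratr_rmorphism char0)) mmapX; congr (_ * _).
by rewrite /mmap1; apply: eq_bigr => i _; rewrite mnmE.
Qed.

(** Algebraicity is handled as integrality over the subfield Q(x, z), which is stable under the
    field operations and propagates along the clauses of [inR]; the clause for xi is the quadratic
    equation. *)
Lemma Kfield_algebraic :
  (forall y, algebraic_over (in_adjoin x) y) ->
  forall y, algebraic_over (in_adjoin extend_basis) y.
Proof.
move=> algF; pose E0 := in_adjoin_closed pchar_Kfield extend_basis.
pose iota : {rmorphism subfield E0 -> K} := @sfval _ _ E0.
have in_int w : in_adjoin extend_basis w -> integralOver iota w.
  by move=> hw; have [w' <-] := sfval_ex E0 hw; apply: integral_id.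
have adj i : in_adjoin extend_basis (extend_basis i).
  exists 'X_i, 1; rewrite !(rat_evalE pchar_Kfield) rmorph1 oner_neq0 divr1.
  by rewrite mmapX mmap1U.
have intX : integralOver iota varK by rewrite -extend_basis_max; apply/in_int/adj.
have adjC a : in_adjoin x a -> in_adjoin extend_basis (constK a).
  have emb (p : {mpoly rat[r]}) : exists p',
      rat_eval extend_basis p' = constK (rat_eval x p).
    exists (\sum_(m <- msupp p) (p@_m)%:MP
              * \prod_i 'X_(widen_ord (leqnSn r) i) ^+ m i).
    rewrite (rat_evalE pchar_Kfield) rmorph_sum [rat_eval x p]/mmap [RHS]rmorph_sum.
    apply: eq_bigr => m _; rewrite [LHS]rmorphM [RHS]rmorphM /mmap1.
    rewrite [LHS](congr1 (GRing.mul^~ _) (mmapC _ _ _)).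
    rewrite !rmorph_prod; congr (_ * _).
      by have := fmorph_rat constK p@_m.
    apply: eq_bigr => j _; rewrite [LHS]rmorphXn [RHS]rmorphXn; congr (_ ^+ _).
    transitivity (extend_basis (widen_ord (leqnSn r) j)); last exact: extend_basis_widen.
    exact: etrans (mmapX extend_basis (ratr_rmorphism pchar_Kfield) _) (mmap1U _ _).
  case=> p [q [q0 ->]]; have [p' p'E] := emb p; have [q' q'E] := emb q.
  exists p', q'; rewrite p'E q'E fmorph_eq0; split=> //.
  by rewrite rmorphM /= fmorphV.
have intC a : integralOver iota (constK a).
  have [p [p0 hp pa]] := algF a.
  apply: (@integral_root _ _ iota (map_poly constK p)).
  - by rewrite map_poly_eq0.
  - exact: rmorph_root.
  - by apply/integral_poly => i; rewrite coef_map; apply/in_int/adjC.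
have intR f : inR f -> forall y : K, sfval y = tofrac f -> integralOver iota y.
  elim=> {f} [a||f g hf IHf hg IHg|f g hf IHf hg IHg|f hf IHf] y yE.
  - have -> : y = constK a by apply: sfval_inj.
    exact: intC.
  - have -> : y = varK by apply: sfval_inj.
    exact: intX.
  - have [u uE] := sfval_ex (inK_closed F) (inK_tofrac hf).
    have [v vE] := sfval_ex (inK_closed F) (inK_tofrac hg).
    have -> : y = u + v by apply: sfval_inj; rewrite yE [RHS]rmorphD /= uE vE tofracD.
    by apply: integral_add; [apply: IHf uE|apply: IHg vE].
  - have [u uE] := sfval_ex (inK_closed F) (inK_tofrac hf).
    have [v vE] := sfval_ex (inK_closed F) (inK_tofrac hg).
    have -> : y = u * v by apply: sfval_inj; rewrite yE [RHS]rmorphM /= uE vE tofracM.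
    by apply: integral_mul; [apply: IHf uE|apply: IHg vE].
  - have [u uE] := sfval_ex (inK_closed F) (inK_tofrac hf).
    have yu : y = u + varK * y ^+ 2.
      apply: sfval_inj; rewrite [RHS]rmorphD [X in _ = _ + X]rmorphM rmorphXn /= yE uE.
      by rewrite -tofracXn -tofracM -tofracD -xiE.
    exact: quadratic_integral intX (IHf u uE) yu.
move=> y; have : integralOver iota y.
  have [f [g [hf hg yE]]] := sfvalP y.
  have [u uE] := sfval_ex (inK_closed F) (inK_tofrac hf).
  have [v vE] := sfval_ex (inK_closed F) (inK_tofrac hg).
  have -> : y = u / v by apply: sfval_inj; rewrite [RHS]rmorphM fmorphV /= uE vE yE.
  by apply: integral_div; [apply: intR uE|apply: intR vE].
case/integral_algebraic=> p p0 py; exists (map_poly iota p); split=> //.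
- by rewrite map_poly_eq0.
- by move=> i; rewrite coef_map; apply: sfvalP.
Qed.

End Basis.

Lemma Kfield_trdeg r : has_trdeg F r -> has_trdeg K r.+1.
Proof.
case=> x [indep alg]; exists (extend_basis x); split.
- exact: extend_basis_independent.
- exact: Kfield_algebraic.
Qed.

End TrDeg.

(** * The presentation of the field *)

(** An index for the family of oracles: programs read the diagram of [fp_str], while correctness
    proofs speak about the field that it presents. *)
Record fpres := FPres {
  fp_str : structure;
  fp_field : fieldType;
  fp_phi : nat -> fp_field;
  fp_presents : presents fp_str fp_phi;
  fp_char0 : [pchar fp_field] =i pred0 }.

Definition fp_oracle (i : fpres) : nat -> nat := diagram (fp_str i).

Definition code_par a := (3 * a).+2.
Definition code_add x y := (3 * cpair x y + 1).+2.
Definition code_mul x y := (3 * cpair x y + 2).+2.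

Lemma decode_par a : term_decode (code_par a) = Par a.
Proof. by rewrite term_decodeS mulKn // modnMr. Qed.
Lemma decode_add x y : term_decode (code_add x y) = Add (term_decode x) (term_decode y).
Proof.
rewrite term_decodeS mulnC modnMDl divnMDl // addn0 /= fstcK sndcK //.
Qed.
Lemma decode_mul x y : term_decode (code_mul x y) = Mul (term_decode x) (term_decode y).
Proof.
rewrite term_decodeS mulnC modnMDl divnMDl // addn0 /= fstcK sndcK //.
Qed.

Section Operations.

Lemma cmp_diagram m a : cmp fp_oracle m a ->
  cmp fp_oracle m (fun i v => diagram (fp_str i) (a i v)).
Proof. exact: cmp_oracle. Qed.

(** The diagram only decides equations, so the value of a constant or operation is found by
    searching for the parameter equal to the term. *)
Lemma cmp_zero : cmp1 fp_oracle (fun i _ => s_zero (fp_str i)).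
Proof.
have h : cmp2 fp_oracle (fun i y _ => diagram (fp_str i) (cpair 0 (code_par y))).
  by apply: cmp_diagram; rewrite /code_par; cmp_auto.
move/cmp_search: h; apply=> i v _; have dE y := diagramP (fp_str i) Zero (Par y).
split=> [|y]; first by have := dE (s_zero (fp_str i)); rewrite /= eqxx.
by have := dE y; rewrite /= /cpair => -> /eqP ->.
Qed.

Lemma cmp_one : cmp1 fp_oracle (fun i _ => s_one (fp_str i)).
Proof.
have h : cmp2 fp_oracle (fun i y _ => diagram (fp_str i) (cpair 1 (code_par y))).
  by apply: cmp_diagram; rewrite /code_par; cmp_auto.
move/cmp_search: h; apply=> i v _; have dE y := diagramP (fp_str i) One (Par y).
split=> [|y]; first by have := dE (s_one (fp_str i)); rewrite /= eqxx.
by have := dE y; rewrite /= /cpair => -> /eqP ->.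
Qed.

Lemma cmp_sadd : cmp2 fp_oracle (fun i a b => s_add (fp_str i) a b).
Proof.
have h : cmp3 fp_oracle (fun i y a b => diagram (fp_str i)
    (cpair (code_add (code_par a) (code_par b)) (code_par y))).
  by apply: cmp_diagram; rewrite /code_add /code_par; cmp_auto.
move/cmp_search: h; apply=> i v _; set a := nth _ v 0; set b := nth _ v 1.
have dE y := diagramP (fp_str i) (Add (Par a) (Par b)) (Par y).
split=> [|y]; first by have := dE (s_add (fp_str i) a b); rewrite /= eqxx.
by have := dE y; rewrite /= /cpair => -> /eqP ->.
Qed.

Lemma cmp_smul : cmp2 fp_oracle (fun i a b => s_mul (fp_str i) a b).
Proof.
have h : cmp3 fp_oracle (fun i y a b => diagram (fp_str i)
    (cpair (code_mul (code_par a) (code_par b)) (code_par y))).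
  by apply: cmp_diagram; rewrite /code_mul /code_par; cmp_auto.
move/cmp_search: h; apply=> i v _; set a := nth _ v 0; set b := nth _ v 1.
have dE y := diagramP (fp_str i) (Mul (Par a) (Par b)) (Par y).
split=> [|y]; first by have := dE (s_mul (fp_str i) a b); rewrite /= eqxx.
by have := dE y; rewrite /= /cpair => -> /eqP ->.
Qed.

(** A product needs [k.+1] summands of index sum [k], and the recursion for xi needs [k] summands of
    index sum [k.-1]; hence both [n] and [k]. The number [p] packs a length and two lists to keep
    the arity low. *)
Definition conv (i : fpres) n k p : nat :=
  nat_rec (fun=> nat) (s_zero (fp_str i)) (fun j s => s_add (fp_str i) s
    (s_mul (fp_str i) (look (fstc p) (fstc (sndc p)) j)
                      (look (fstc p) (sndc (sndc p)) (k - j)))) n.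

Definition list_zero (i : fpres) N := tab (fun _ _ => s_zero (fp_str i)) N.
Definition list_var (i : fpres) N :=
  tab (fun k _ => if k == 1 then s_one (fp_str i) else s_zero (fp_str i)) N.
Definition list_par (i : fpres) N a :=
  tab (fun k _ => if k == 0 then a else s_zero (fp_str i)) N.
Definition list_add (i : fpres) N L M :=
  tab (fun k _ => s_add (fp_str i) (look N L k) (look N M k)) N.
Definition list_mul (i : fpres) N L M :=
  tab (fun k _ => conv i k.+1 k (cpair N (cpair L M))) N.
(** At stage [k] the table [T] under construction has length [k] and holds exactly the earlier
    coefficients of xi that the next one depends on. *)
Definition list_xi (i : fpres) N L :=
  tab (fun k T => s_add (fp_str i) (look N L k) (conv i k k.-1 (cpair k (cpair T T)))) N.

Definition coefc (i : fpres) N c := tfold (list_zero i N) (list_var i N) (list_par i N)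
  (list_add i N) (list_mul i N) (list_xi i N) (term_decode c).

(** [eigen_bound] gives the index bound 2 h 2^h, where h counts the occurrences of [One] and is at
    most [c] by [ones_decode]. The successor includes that index in the test. *)
Definition prec c := (c * 2 * 2 ^ c).+1.

Definition zero_test (i : fpres) c : bool :=
  all_below (prec c) (fun k => look (prec c) (coefc i (prec c) c) k == s_zero (fp_str i)).

Lemma cmp_conv : cmp3 fp_oracle conv.
Proof.
have hz := cmp_zero; have ha := cmp_sadd; have hm := cmp_smul.
apply: (rec2 (b := fun i _ _ => s_zero (fp_str i))).
  exact: (app1 cmp_zero (cmp_proj _ 2 0)).
rewrite /cmp4; refine (app2 ha _ _); first exact: cmp_proj.
by refine (app2 hm _ _); cmp_auto.
Qed.

Lemma cmp_coefc : cmp2 fp_oracle coefc.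
Proof.
have hz := cmp_zero; have ho := cmp_one; have ha := cmp_sadd; have hc := cmp_conv.
rewrite /coefc; apply: cmp_tfold.
- have h : cmp3 fp_oracle (fun i k T x => s_zero (fp_str i)) by exact: (app1 hz (cmp_proj _ 3 0)).
  exact: (app2 (cmp_tab1 h) (cmp_proj _ 1 0) (cmp_proj _ 1 0)).
- have h : cmp3 fp_oracle (fun i k T x => if k == 1 then s_one (fp_str i) else s_zero (fp_str i)).
    apply: cmp_if; first by cmp_auto.
      exact: (app1 ho (cmp_proj _ 3 0)).
    exact: (app1 hz (cmp_proj _ 3 0)).
  exact: (app2 (cmp_tab1 h) (cmp_proj _ 1 0) (cmp_proj _ 1 0)).
- have h : cmp3 fp_oracle (fun i k T x => if k == 0 then x else s_zero (fp_str i)).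
    apply: cmp_if; [by cmp_auto|exact: cmp_proj|exact: (app1 hz (cmp_proj _ 3 0))].
  exact: (app2 (cmp_tab1 h) (cmp_proj _ 2 0) (cmp_proj _ 2 1)).
- have h : cmp4 fp_oracle (fun i k T N p =>
      s_add (fp_str i) (look N (fstc p) k) (look N (sndc p) k)).
    by refine (app2 ha _ _); cmp_auto.
  apply: cmp_ext (app3 (cmp_tab2 h) (cmp_proj _ 3 0) (cmp_proj _ 3 0)
    (app2 (cmp_pair _) (cmp_proj _ 3 1) (cmp_proj _ 3 2))) => i v _.
  by rewrite fstcK sndcK.
- have h : cmp3 fp_oracle (fun i k T p => conv i k.+1 k p) by refine (app3 hc _ _ _); cmp_auto.
  by refine (app2 (cmp_tab1 h) _ _); cmp_auto.
- have h : cmp4 fp_oracle (fun i k T N L =>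
      s_add (fp_str i) (look N L k) (conv i k k.-1 (cpair k (cpair T T)))).
    by refine (app2 ha _ _); [|refine (app3 hc _ _ _)]; cmp_auto.
  exact: (app3 (cmp_tab2 h) (cmp_proj _ 2 0) (cmp_proj _ 2 0) (cmp_proj _ 2 1)).
Qed.

Lemma cmp_zero_test : cmp1 fp_oracle (fun i c => zero_test i c).
Proof.
have hz := cmp_zero; have hc := cmp_coefc.
have hp : cmp1 fp_oracle (fun _ c => prec c) by rewrite /prec; cmp_auto.
have h : cmp3 fp_oracle (fun i k N c => look N (coefc i N c) k == s_zero (fp_str i)).
  refine (app2 (cmp_eqn _) _ _); last exact: (app1 hz (cmp_proj _ 3 0)).
  by refine (app3 (cmp_look _) _ _ _); [..|refine (app2 hc _ _)|]; cmp_auto.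
have hpc := app1 hp (cmp_proj _ 1 0).
exact: (app3 (cmp_all_below2 h) hpc hpc (cmp_proj _ 1 0)).
Qed.

End Operations.

Section Correctness.
Variable i : fpres.
Local Notation A := (fp_str i).
Local Notation F := (fp_field i).
Local Notation phi := (@fp_phi i).
Let pres := fp_presents i.

Definition code_val c : pseries F := peval phi (term_decode c).

Lemma phi_inj : injective phi. Proof. exact: bij_inj (pres_bij pres). Qed.
Lemma phi_surj a : exists n, phi n = a.
Proof. by have [g _ gK] := pres_bij pres; exists (g a). Qed.

Definition lists N L (f : pseries F) := forall k, (k < N)%N -> phi (look N L k) = f k.

Lemma convE n k N L M : phi (conv i n k (cpair N (cpair L M))) =
  \sum_(j < n) phi (look N L j) * phi (look N M (k - j)).
Proof.
elim: n => [|n IH]; first by rewrite big_ord0; apply: pres_zero pres.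
rewrite big_ord_recr -IH /conv [LHS](pres_add pres) (pres_mul pres).
by rewrite fstcK sndcK !fstcK sndcK.
Qed.

Lemma lists_xi N L f : lists N L f -> lists N (list_xi i N L) (xi f).
Proof.
move=> hL k; rewrite /list_xi; set H := fun k T => _.
elim/ltn_ind: k => k IH lt; rewrite (look_tab H lt) {1}/H (pres_add pres) hL // convE.
rewrite xi_coef; congr (_ + _); apply: eq_bigr => j _.
have hj l : (l < k)%N -> phi (look k (tab H k) l) = xi f l.
  move=> lk; rewrite (look_tab H lk) -(look_tab H (ltn_trans lk lt)).
  by apply: IH => //; apply: ltn_trans lt.
have ltj := ltn_ord j; rewrite !hj //; lia.
Qed.

Lemma lists_coefc N c : lists N (coefc i N c) (code_val c).
Proof.
rewrite /coefc /code_val; elim: (term_decode c) => [||a|s IHs t IHt|s IHs t IHt] k lt.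
- by rewrite (look_tab _ lt) (pres_zero pres).
- rewrite (look_tab _ lt) [RHS]/=.
  by case: (k == 1%N); [apply: pres_one pres|apply: pres_zero pres].
- rewrite (look_tab _ lt); case: k lt => [|k] lt //.
  exact: pres_zero pres.
- by rewrite [tfold _ _ _ _ _ _ _]/= (look_tab _ lt) (pres_add pres) IHs // IHt.
- have hM : phi (look N (list_mul i N (tfold (list_zero i N) (list_var i N)
      (list_par i N) (list_add i N) (list_mul i N) (list_xi i N) s)
      (tfold (list_zero i N) (list_var i N) (list_par i N) (list_add i N)
      (list_mul i N) (list_xi i N) t)) k) = (peval phi s * peval phi t) k.
    rewrite (look_tab _ lt) convE psM; apply: eq_bigr => j _.
    by have ltj := ltn_ord j; rewrite IHs ?IHt //; lia.
  by case: s IHs hM => [||a|s1 s2|s1 s2] IHs hM; try exact: hM; apply: lists_xi.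
Qed.

(** A Cantor code is at least the sum of its components, so the counts of two subterms together stay
    below the code of the compound. *)
Lemma ones_decode c : (ones (term_decode c) <= c)%N.
Proof.
elim/ltn_ind: c => -[|[|m]] // IH; rewrite term_decodeS.
have d3 : (m %/ 3 <= m)%N by apply: leq_div.
have h1 : (fstc (m %/ 3) < m.+2)%N by have := fstc_le (m %/ 3); lia.
have h2 : (sndc (m %/ 3) < m.+2)%N by have := sndc_le (m %/ 3); lia.
have hs : (fstc (m %/ 3) + sndc (m %/ 3) <= m %/ 3)%N.
  rewrite -[X in (_ <= X)%N]paircK; apply/leP.
  by have := Cantor.to_nat_non_decreasing (fstc (m %/ 3)) (sndc (m %/ 3)); rewrite /cpair; lia.
have i1 := IH _ h1; have i2 := IH _ h2; have := leq_add i1 i2.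
by case: (m %% 3)%N => [|[|?]] // h; rewrite [ones _]/= (leq_trans h) //; lia.
Qed.

Lemma zero_testP c : reflect (code_val c = 0) (zero_test i c).
Proof.
apply: (iffP (all_belowP _ _)) => [h|h k lt]; last first.
  apply/eqP/phi_inj; rewrite lists_coefc // h ps0; exact: esym (pres_zero pres).
apply/eqP/negPn/negP => c0; have [n le] := eigen_bound (eigen_peval phi _) c0.
have lt : (n < prec c)%N.
  rewrite ltnS (leq_trans le) // -muln2 leq_mul // ?leq_pexp2l ?leq_mul2r ?ones_decode ?orbT //.
by rewrite -(lists_coefc c lt) (eqP (h n lt)) (pres_zero pres) eqxx.
Qed.

Lemma code_val_par a : code_val (code_par a) = psC (phi a).
Proof. by rewrite /code_val decode_par. Qed.
Lemma code_val_add x y : code_val (code_add x y) = code_val x + code_val y.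
Proof. by rewrite /code_val decode_add. Qed.
(* The dummy summand [Zero] keeps the left factor from being [One]. *)
Definition code_prod x y := code_mul (code_add 0 x) y.

Lemma code_val_prod x y : code_val (code_prod x y) = code_val x * code_val y.
Proof. by rewrite /code_val decode_mul decode_add /= add0r. Qed.

Lemma code_val_surj f : inR f -> exists c, code_val c = f.
Proof.
move=> /(inR_peval phi_surj)[t ->]; exists (term_code t).
by rewrite /code_val term_codeK.
Qed.

Lemma code_val_inR c : inR (code_val c). Proof. exact: peval_inR. Qed.

Definition num n : pseries F := code_val (fstc n).
Definition den n : pseries F := code_val (sndc n).

Lemma inK_num_den n : inK (tofrac (num n) / tofrac (den n)).
Proof. by exists (num n), (den n); split=> //; apply: code_val_inR. Qed.

Definition raw_val n : Kfield F :=
  Subfield (introT (asboolP _) (inK_num_den n) : _ \in in_subfield (inK_closed F)).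

Lemma raw_valE n : sfval (raw_val n) = tofrac (num n) / tofrac (den n). Proof. by []. Qed.

Definition valid n := ~~ zero_test i (sndc n).

Lemma validP n : reflect (den n <> 0) (valid n).
Proof. by apply: (iffP idP) => [/zero_testP|/zero_testP]. Qed.

Lemma valid_neq0 n : valid n -> tofrac (den n) != 0.
Proof. by move/validP/eqP; rewrite tofrac_eq0. Qed.

Lemma raw_val_eq n m : valid n -> valid m ->
  raw_val n = raw_val m <-> num n * den m = num m * den n.
Proof.
move=> /valid_neq0 n0 /valid_neq0 m0; split=> [h|h].
  have /eqP := congr1 (@sfval _ _ _) h; rewrite !raw_valE eqr_div // -!tofracM.
  by move/eqP/tofrac_inj.
apply: sfval_inj; rewrite !raw_valE; apply/eqP; rewrite eqr_div // -!tofracM.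
by rewrite h.
Qed.

Lemma raw_val_surj x : exists2 n, valid n & raw_val n = x.
Proof.
have [f [g [hf hg xE]]] := sfvalP x.
have [f' [g' [hf' hg' g'0 x'E]]] : exists f' g',
    [/\ inR f', inR g', g' <> 0 & sfval x = tofrac f' / tofrac g'].
  have [g0|g0] := eqVneq g 0; last by exists f, g; split=> //; apply/eqP.
  exists 0, 1; split; [exact: inR0|exact: inR1|by apply/eqP; apply: oner_neq0|].
  by rewrite xE g0 tofrac0 invr0 mulr0 mul0r.
have [a aE] := code_val_surj hf'; have [b bE] := code_val_surj hg'.
exists (cpair a b); first by apply/validP; rewrite /den sndcK bE.
by apply: sfval_inj; rewrite raw_valE /num /den fstcK sndcK aE bE x'E.
Qed.

Definition raw_add n m := cpair
  (code_add (code_prod (fstc n) (sndc m)) (code_prod (fstc m) (sndc n)))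
  (code_prod (sndc n) (sndc m)).
Definition raw_mul n m :=
  cpair (code_prod (fstc n) (fstc m)) (code_prod (sndc n) (sndc m)).
Definition raw_zero := cpair 0 (code_par (s_one A)).
Definition raw_one := cpair (code_par (s_one A)) (code_par (s_one A)).

Lemma num_add n m : num (raw_add n m) = num n * den m + num m * den n.
Proof. by rewrite /num /den fstcK code_val_add !code_val_prod. Qed.
Lemma den_add n m : den (raw_add n m) = den n * den m.
Proof. by rewrite /den sndcK code_val_prod. Qed.
Lemma num_mul n m : num (raw_mul n m) = num n * num m.
Proof. by rewrite /num fstcK code_val_prod. Qed.
Lemma den_mul n m : den (raw_mul n m) = den n * den m.
Proof. by rewrite /den sndcK code_val_prod. Qed.
Lemma code_val_one : code_val (code_par (s_one A)) = 1.
Proof. by rewrite code_val_par (pres_one pres) rmorph1. Qed.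
Lemma num_zero : num raw_zero = 0. Proof. by rewrite /num fstcK. Qed.
Lemma den_zero : den raw_zero = 1. Proof. by rewrite /den sndcK code_val_one. Qed.
Lemma num_one : num raw_one = 1. Proof. by rewrite /num fstcK code_val_one. Qed.
Lemma den_one : den raw_one = 1. Proof. by rewrite /den sndcK code_val_one. Qed.

Lemma valid_den1 n : den n = 1 -> valid n.
Proof. by move=> d1; apply/validP; rewrite d1; apply/eqP; apply: oner_neq0. Qed.
Lemma valid_denM n m k : valid n -> valid m -> den k = den n * den m -> valid k.
Proof.
move=> /validP/eqP n0 /validP/eqP m0 kE.
by apply/validP; rewrite kE; apply/eqP; rewrite mulf_neq0.
Qed.

Lemma raw_val_add n m : valid n -> valid m -> raw_val (raw_add n m) = raw_val n + raw_val m.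
Proof.
move=> /valid_neq0 n0 /valid_neq0 m0; apply: sfval_inj.
rewrite [RHS]rmorphD [RHS](addf_div _ _ n0 m0) !raw_valE num_add den_add.
by rewrite tofracD !tofracM.
Qed.

Lemma raw_val_mul n m : raw_val (raw_mul n m) = raw_val n * raw_val m.
Proof.
apply: sfval_inj; rewrite [RHS]rmorphM [RHS]mulf_div !raw_valE num_mul den_mul.
by rewrite !tofracM.
Qed.

Lemma raw_val_zero : raw_val raw_zero = 0.
Proof. by apply: sfval_inj; rewrite raw_valE num_zero tofrac0 mul0r rmorph0. Qed.
Lemma raw_val_one : raw_val raw_one = 1.
Proof. by apply: sfval_inj; rewrite raw_valE num_one den_one tofrac1 divr1 rmorph1. Qed.

Lemma neg_one_ex : exists a, s_add A a (s_one A) = s_zero A.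
Proof.
have [a aE] := phi_surj (-1); exists a; apply: phi_inj.
by rewrite (pres_add pres) (pres_zero pres) (pres_one pres) aE addNr.
Qed.

(** The signature has no subtraction; an element for -1 lets [raw_eq] compare cross products by
    means of the zero test. *)
Definition neg_one : nat := ex_minn (P := fun a => s_add A a (s_one A) == s_zero A)
  (let: ex_intro a h := neg_one_ex in ex_intro _ a (introT eqP h)).

Lemma phi_neg_one : phi neg_one = -1.
Proof.
rewrite /neg_one; case: ex_minnP => a /eqP ha _; apply/eqP.
by rewrite -subr_eq0 opprK -(pres_one pres) -(pres_add pres) ha (pres_zero pres).
Qed.

Definition raw_eq n m := zero_test i (code_add (code_prod (fstc n) (sndc m))
  (code_prod (code_par neg_one) (code_prod (fstc m) (sndc n)))).

Lemma raw_eqP n m : valid n -> valid m -> reflect (raw_val n = raw_val m) (raw_eq n m).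
Proof.
move=> hn hm; apply: (iffP (zero_testP _)); rewrite code_val_add !code_val_prod.
  rewrite code_val_par phi_neg_one rmorphN1 mulN1r => /eqP; rewrite subr_eq0 => /eqP h.
  exact/raw_val_eq.
by move/(raw_val_eq hn hm) => h; rewrite code_val_par phi_neg_one rmorphN1 mulN1r /= -/(num n)
  -/(num m) -/(den n) -/(den m) h subrr.
Qed.

(** The universe [nat] must name each element exactly once, and the least valid code of an element
    is a decidable choice of name. *)
Definition rep n := valid n && all_below n (fun m => ~~ (valid m && raw_eq m n)).

Lemma rep_valid n : rep n -> valid n. Proof. by case/andP. Qed.

Lemma rep_inj n m : rep n -> rep m -> raw_val n = raw_val m -> n = m.
Proof.
wlog le : n m / (n <= m)%N => [W rn rm E|rn rm E].
  by case/orP: (leq_total n m) => le; [apply: W|apply/esym/W].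
apply/eqP; move: le; rewrite leq_eqVlt => /orP[//|lt].
case/andP: rm => vm /(elimT (all_belowP _ _))/(_ n lt); rewrite (rep_valid rn) andTb.
by case: raw_eqP => //; apply: rep_valid.
Qed.

Lemma rep_surj x : exists2 n, rep n & raw_val n = x.
Proof.
have ex : exists n, valid n && (raw_val n == x).
  by have [n vn <-] := raw_val_surj x; exists n; rewrite vn eqxx.
exists (ex_minn ex); case: ex_minnP => n /andP[vn /eqP vE] hn //.
rewrite /rep vn; apply/all_belowP => m lt; apply/negP => /andP[vm].
case: raw_eqP => // E _; have := hn m; rewrite vm E vE eqxx => /(_ isT).
by rewrite leqNgt lt.
Qed.

(** In characteristic 0 the natural numbers are pairwise distinct in K. Infinitude is what keeps the
    enumeration of representatives from ending. *)
Lemma Kfield_fresh (s : seq (Kfield F)) : exists x, x \notin s.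
Proof.
apply: contrapT => /forallNP h.
have all x : x \in s by apply/negPn/negP.
pose t := [seq (n%:R : Kfield F) | n <- iota 0 (size s).+1].
have ut : uniq t.
  have inj m n : (m <= n)%N -> n%:R = m%:R :> Kfield F -> m = n.
    move=> le /eqP; rewrite -subr_eq0 -natrB //.
    rewrite (proj1 (pcharf0P _) (pchar_Kfield (fp_char0 i))) subn_eq0 => ge.
    by apply/eqP; rewrite eqn_leq le.
  rewrite map_inj_uniq ?iota_uniq // => m n E.
  by case/orP: (leq_total m n) => /inj e; [|symmetry]; apply: e.
have /(uniq_leq_size ut) : {subset t <= s} by move=> x _; apply: all.
by rewrite size_map size_iota ltnn.
Qed.

Lemma rep_unbounded a : exists n, (a <= n)%N && rep n.
Proof.
have [x hx] := Kfield_fresh [seq raw_val n | n <- iota 0 a].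
have [n rn vn] := rep_surj x; exists n; rewrite rn andbT leqNgt; apply/negP => lt.
by case/mapP: hx; exists n => //; rewrite mem_iota.
Qed.

Definition next_rep a : nat := ex_minn (rep_unbounded a).

Definition enum_rep k : nat :=
  nat_rec (fun=> nat) (next_rep 0) (fun _ n => next_rep n.+1) k.

Lemma enum_rep_rep k : rep (enum_rep k).
Proof. by case: k => [|k] /=; rewrite /next_rep; case: ex_minnP => n /andP[]. Qed.

Lemma enum_rep_lt k : (enum_rep k < enum_rep k.+1)%N.
Proof. by rewrite {2}/enum_rep /= /next_rep; case: ex_minnP => n /andP[]. Qed.

Lemma enum_rep_mono j k : (j < k)%N -> (enum_rep j < enum_rep k)%N.
Proof.
elim: k => // k IH; rewrite ltnS leq_eqVlt => /orP[/eqP ->|/IH h].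
  exact: enum_rep_lt.
exact: ltn_trans h (enum_rep_lt k).
Qed.

Lemma enum_rep_surj n : rep n -> exists k, enum_rep k = n.
Proof.
move=> rn; have ex : exists k, (n <= enum_rep k)%N.
  exists n; elim: (n) => // k IH; exact: leq_ltn_trans IH (enum_rep_lt k).
exists (ex_minn ex); case: ex_minnP => -[|k] le hk; apply/eqP; rewrite eqn_leq le andbT.
  by rewrite /= /next_rep; case: ex_minnP => m _; apply.
have lt : (enum_rep k < n)%N by rewrite ltnNge; apply/negP => /hk; rewrite ltnn.
by rewrite /= /next_rep; case: ex_minnP => m _; apply; rewrite lt.
Qed.

Definition Kphi k : Kfield F := raw_val (enum_rep k).

Lemma Kphi_inj : injective Kphi.
Proof.
move=> j k E; have e : enum_rep j = enum_rep k by apply: rep_inj E; apply: enum_rep_rep.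
case: (ltngtP j k) => // /enum_rep_mono; by rewrite e ltnn.
Qed.

Lemma Kphi_surj x : exists k, Kphi k = x.
Proof.
have [n rn <-] := rep_surj x; have [k <-] := enum_rep_surj rn; by exists k.
Qed.

Definition Kidx x : nat := projT1 (cid (Kphi_surj x)).
Lemma KidxK : cancel Kidx Kphi. Proof. by move=> x; rewrite /Kidx; case: cid. Qed.

(** [Kidx] is a classical choice, so the operations are not visibly computable. What gets computed
    is the diagram, which [diagram_Kstr] expresses through codes alone. *)
Definition Kstr : structure := Structure (Kidx 0) (Kidx 1)
  (fun a b => Kidx (Kphi a + Kphi b)) (fun a b => Kidx (Kphi a * Kphi b)).

Lemma Kstr_presents : presents Kstr Kphi.
Proof.
split=> [|||a b|a b]; rewrite /= ?KidxK //.
by exists Kidx; [move=> k; apply: Kphi_inj; rewrite KidxK|exact: KidxK].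
Qed.

(** Here the terms belong to the language of fields over [Kstr], so [Mul One t] must be an honest
    product, which the last argument provides. Results stay raw codes, so no index has to be looked
    up. *)
Definition raw_term c := tfold raw_zero raw_one enum_rep raw_add raw_mul
  (raw_mul raw_one) (term_decode c).

Lemma raw_termP c :
  valid (raw_term c) /\ raw_val (raw_term c) = Kphi (term_val Kstr (term_decode c)).
Proof.
rewrite /raw_term; elim: (term_decode c) => [||a|s [vs es] t [vt et]|s [vs es] t [vt et]].
- by rewrite valid_den1 ?den_zero // raw_val_zero /= KidxK.
- by rewrite valid_den1 ?den_one // raw_val_one /= KidxK.
- by split=> //; apply: rep_valid; apply: enum_rep_rep.
- rewrite [tfold _ _ _ _ _ _ _]/= (valid_denM vs vt) ?den_add //.
  by rewrite raw_val_add // es et [term_val _ _]/= KidxK.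
- rewrite (_ : tfold _ _ _ _ _ _ _ = raw_mul
    (tfold raw_zero raw_one enum_rep raw_add raw_mul (raw_mul raw_one) s)
    (tfold raw_zero raw_one enum_rep raw_add raw_mul (raw_mul raw_one) t)); last first.
    by case: (s).
  by rewrite (valid_denM vs vt) ?den_mul // raw_val_mul es et [term_val _ _]/= KidxK.
Qed.

Lemma diagram_Kstr n :
  diagram Kstr n = raw_eq (raw_term (fstc n)) (raw_term (sndc n)).
Proof.
have [v1 e1] := raw_termP (fstc n); have [v2 e2] := raw_termP (sndc n).
rewrite /diagram -/(fstc n) -/(sndc n).
apply/eqP/idP => [h|/(raw_eqP v1 v2)]; last by rewrite e1 e2 => /Kphi_inj.
by apply/(raw_eqP v1 v2); rewrite e1 e2 h.
Qed.

Lemma FD_Kstr r : has_trdeg F r -> FD r.+1 Kstr.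
Proof.
move=> tF; exists (Kfield F), Kphi; split; first exact: Kstr_presents.
  exact: pchar_Kfield (fp_char0 i).
exact: Kfield_trdeg (fp_char0 i) _ tF.
Qed.

End Correctness.

(** * Functoriality *)

Section DiagramProgram.

Lemma cmp_neg_one : cmp1 fp_oracle (fun i _ => neg_one i).
Proof.
have hz := cmp_zero; have ho := cmp_one; have ha := cmp_sadd.
have h : cmp2 fp_oracle (fun i a _ => s_add (fp_str i) a (s_one (fp_str i)) == s_zero (fp_str i)).
  refine (app2 (cmp_eqn _) _ _); last exact: (app1 hz (cmp_proj _ 2 0)).
  by refine (app2 ha _ _); [exact: cmp_proj|exact: (app1 ho (cmp_proj _ 2 0))].
move/cmp_search: h; apply=> i v _; rewrite /neg_one.
by case: ex_minnP => a ha' hmin; split=> //= b hb; apply: hmin.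
Qed.

Lemma cmp_raw_eq : cmp2 fp_oracle (fun i n m => raw_eq i n m).
Proof.
have hzt := cmp_zero_test; have hn := cmp_neg_one.
rewrite /raw_eq /code_prod /code_add /code_mul /code_par /cmp2.
refine (app1 hzt _); do ?[exact: (app1 hn (cmp_proj _ 2 0)) | cmp_step].
Qed.

Lemma cmp_valid : cmp1 fp_oracle (fun i n => valid i n).
Proof.
have hzt := cmp_zero_test; rewrite /valid /cmp1.
by refine (cmp_negb _); refine (app1 hzt _); cmp_auto.
Qed.

Lemma cmp_rep : cmp1 fp_oracle (fun i n => rep i n).
Proof.
have hv := cmp_valid; have he := cmp_raw_eq; rewrite /rep.
have h : cmp2 fp_oracle (fun i m n => ~~ (valid i m && raw_eq i m n)).
  refine (cmp_negb (cmp_andb _ _)); first exact: (app1 hv (cmp_proj _ 2 0)).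
  exact: (app2 he (cmp_proj _ 2 0) (cmp_proj _ 2 1)).
refine (cmp_andb _ _); first exact: (app1 hv (cmp_proj _ 1 0)).
exact: (app2 (cmp_all_below1 h) (cmp_proj _ 1 0) (cmp_proj _ 1 0)).
Qed.

Lemma cmp_next_rep : cmp1 fp_oracle next_rep.
Proof.
have hr := cmp_rep.
have h : cmp2 fp_oracle (fun i n a => (a <= n)%N && rep i n).
  refine (cmp_andb _ _); first by cmp_auto.
  exact: (app1 hr (cmp_proj _ 2 0)).
move/cmp_search: h; apply=> i v _; rewrite /next_rep.
by case: ex_minnP => n hn hmin; split=> //= m hm; apply: hmin.
Qed.

Lemma cmp_enum_rep : cmp1 fp_oracle enum_rep.
Proof.
have hn := cmp_next_rep.
have hs : cmp2 fp_oracle (fun i _ n => next_rep i n.+1) by refine (app1 hn _); cmp_auto.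
apply: (rec0 (b := fun i => next_rep i 0) _ hs).
exact: (app1 hn (cmp_const _ 0 0)).
Qed.

Lemma cmp_raw_term : cmp1 fp_oracle raw_term.
Proof.
have ho := cmp_one; have he := cmp_enum_rep.
have hone : cmp1 fp_oracle (fun i _ => raw_one i).
  rewrite /raw_one /code_par /cmp1.
  by do ?[exact: (app1 ho (cmp_proj _ 1 0)) | cmp_step].
have hmul : cmp2 fp_oracle (fun _ n m => raw_mul n m).
  by rewrite /raw_mul /code_prod /code_mul /code_add; cmp_auto.
have h : cmp2 fp_oracle (fun i p c => tfold (raw_zero i) (raw_one i) (enum_rep i) raw_add raw_mul
    (raw_mul (raw_one i)) (term_decode c)).
  apply: (cmp_tfold (z := fun i _ => raw_zero i) (u := fun i _ => raw_one i)
    (par := fun i _ => enum_rep i) (add := fun _ _ => raw_add) (mul := fun _ _ => raw_mul)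
    (ksi := fun i _ => raw_mul (raw_one i))).
  - rewrite /raw_zero /code_par /cmp1.
    by do ?[exact: (app1 ho (cmp_proj _ 1 0)) | cmp_step].
  - exact: hone.
  - exact: (app1 he (cmp_proj _ 2 1)).
  - by rewrite /raw_add /code_prod /code_mul /code_add; cmp_auto.
  - exact: (app2 hmul (cmp_proj _ 3 1) (cmp_proj _ 3 2)).
  - exact: (app2 hmul (app1 hone (cmp_proj _ 2 0)) (cmp_proj _ 2 1)).
exact: (app2 h (cmp_const _ 1 0) (cmp_proj _ 1 0)).
Qed.

Lemma cmp_diagram_Kstr : cmp1 fp_oracle (fun i n => diagram (Kstr i) n).
Proof.
have he := cmp_raw_eq; have ht := cmp_raw_term.
have h : cmp1 fp_oracle (fun i n => raw_eq i (raw_term i (fstc n)) (raw_term i (sndc n))).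
  by refine (app2 he (app1 ht _) (app1 ht _)); cmp_auto.
by apply: cmp_ext h => i v _; rewrite diagram_Kstr.
Qed.

End DiagramProgram.

Record fiso := FIso {
  fi_src : fpres;
  fi_tgt : fpres;
  fi_map : nat -> nat;
  fi_iso : iso (fp_str fi_src) (fp_str fi_tgt) fi_map }.

Definition fi_oracle (j : fiso) : nat -> nat :=
  iso_oracle (fp_str (fi_src j)) (fp_str (fi_tgt j)) (fi_map j).

Definition coef_map (F F' : fieldType) (h : F -> F') (f : pseries F) : pseries F' :=
  PSeries (fun n => h (f n)).

Section CoefMap.
Variables (F F' : fieldType) (h : {rmorphism F -> F'}).
Local Notation hs := (coef_map h).

Lemma coef_mapD f g : hs (f + g) = hs f + hs g.
Proof. by apply: pseriesP => n /=; rewrite rmorphD. Qed.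
Lemma coef_mapM f g : hs (f * g) = hs f * hs g.
Proof.
apply: pseriesP => n; rewrite -[LHS]/(h ((f * g) n)) psM rmorph_sum psM.
by apply: eq_bigr => j _; rewrite rmorphM.
Qed.
Lemma coef_mapC a : hs (psC a) = psC (h a).
Proof. by apply: pseriesP => -[|n] //=; rewrite rmorph0. Qed.
Lemma coef_mapX : hs (psX F) = psX F'.
Proof. by apply: pseriesP => n /=; rewrite rmorph_nat. Qed.
Lemma coef_map0 : hs 0 = 0.
Proof. by apply: pseriesP => n /=; rewrite rmorph0. Qed.
(** xi is characterized by its equation, which a morphism applied to the coefficients preserves. *)
Lemma coef_map_xi f : hs (xi f) = xi (hs f).
Proof. by apply: xi_unique; rewrite {1}xiE coef_mapD coef_mapM coef_mapX !expr2 coef_mapM. Qed.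
Lemma coef_map_inj : injective hs.
Proof.
move=> f g fg; apply: pseriesP => n; apply: (fmorph_inj h).
exact: (congr1 (fun f : pseries F' => f n) fg).
Qed.

End CoefMap.

Fixpoint term_map (f : nat -> nat) (t : term) : term :=
  match t with
  | Zero => Zero
  | One => One
  | Par a => Par (f a)
  | Add s t => Add (term_map f s) (term_map f t)
  | Mul s t => Mul (term_map f s) (term_map f t)
  end.

Lemma peval_map (F F' : fieldType) (h : {rmorphism F -> F'}) phi phi' f :
  (forall a, h (phi a) = phi' (f a)) ->
  forall t, peval phi' (term_map f t) = coef_map h (peval phi t).
Proof.
move=> hphi; elim=> [||a|s IHs t IHt|s IHs t IHt] /=.
- by rewrite coef_map0.
- by rewrite coef_mapX.
- by rewrite coef_mapC hphi.
- by rewrite coef_mapD IHs IHt.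
- case: s IHs => [||a|s1 s2|s1 s2] IHs; rewrite ?coef_map_xi ?coef_mapM -?IHt -?IHs //.
Qed.

Definition code_map f c := term_code (term_map f (term_decode c)).
Definition raw_map f n := cpair (code_map f (fstc n)) (code_map f (sndc n)).

Lemma presents_morphism (A A' : structure) (E E' : fieldType) (psi : nat -> E)
    (psi' : nat -> E') f : presents A psi -> presents A' psi' -> iso A A' f ->
  exists h : {rmorphism E -> E'}, forall a, h (psi a) = psi' (f a).
Proof.
move=> pA pA' If; have [g psiK gK] := pres_bij pA.
pose h x := psi' (f (g x)).
have hE a : h (psi a) = psi' (f a) by rewrite /h psiK.
have hD x y : h (x + y) = h x + h y.
  by rewrite -[x]gK -[y]gK -(pres_add pA) !hE (iso_add If) (pres_add pA').
have hM x y : h (x * y) = h x * h y.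
  by rewrite -[x]gK -[y]gK -(pres_mul pA) !hE (iso_mul If) (pres_mul pA').
have h1 : h 1 = 1 by rewrite -(pres_one pA) hE (iso_one If) (pres_one pA').
have hB : zmod_morphism h.
  by move=> x y; apply: (addIr (h y)); rewrite -hD !subrK.
pose m1 := GRing.isZmodMorphism.Build E E' h hB.
pose m2 := GRing.isMonoidMorphism.Build E E' h (h1, hM).
by exists (HB.pack h m1 m2 : {rmorphism E -> E'}).
Qed.

Lemma presents_iso (A A' : structure) (E E' : fieldType) (psi : nat -> E)
    (psi' : nat -> E') (h : {rmorphism E -> E'}) :
  presents A psi -> presents A' psi' -> bijective h -> isomorphic A A'.
Proof.
move=> pA pA' bh; have [g psiK gK] := pres_bij pA'.
have fE a : psi' (g (h (psi a))) = h (psi a) by rewrite gK.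
exists (g \o h \o psi); split=> [|||a b|a b] /=.
- apply: bij_comp (pres_bij pA); apply: bij_comp bh; by exists psi'.
- by rewrite (pres_zero pA) rmorph0 -(pres_zero pA') psiK.
- by rewrite (pres_one pA) rmorph1 -(pres_one pA') psiK.
- apply: (bij_inj (pres_bij pA')).
  by rewrite (pres_add pA') !fE (pres_add pA) rmorphD.
- apply: (bij_inj (pres_bij pA')).
  by rewrite (pres_mul pA') !fE (pres_mul pA) rmorphM.
Qed.

Lemma iso_inv (A A' : structure) f g : cancel f g -> cancel g f ->
  iso A A' f -> iso A' A g.
Proof.
move=> fK gK If; split=> [|||a b|a b].
- by exists f.
- by rewrite -(iso_zero If) fK.
- by rewrite -(iso_one If) fK.
- by rewrite -{1}[a]gK -{1}[b]gK -(iso_add If) fK.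
- by rewrite -{1}[a]gK -{1}[b]gK -(iso_mul If) fK.
Qed.

(** * Transport along an isomorphism of base structures *)

Section Transfer.
Variable j : fiso.
Local Notation i := (fi_src j).
Local Notation i' := (fi_tgt j).
Local Notation f := (fi_map j).
Local Notation F := (fp_field i).
Local Notation F' := (fp_field i').

Lemma field_morphism : exists h : {rmorphism F -> F'},
  forall a, h (fp_phi i a) = fp_phi i' (f a).
Proof. exact: presents_morphism (fp_presents i) (fp_presents i') (fi_iso j). Qed.

Lemma code_val_map (h : {rmorphism F -> F'}) : (forall a, h (fp_phi i a) = fp_phi i' (f a)) ->
  forall c, code_val i' (code_map f c) = coef_map h (code_val i c).
Proof. by move=> hE c; rewrite /code_val /code_map term_codeK (peval_map hE). Qed.

Lemma num_map (h : {rmorphism F -> F'}) : (forall a, h (fp_phi i a) = fp_phi i' (f a)) ->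
  forall n, num i' (raw_map f n) = coef_map h (num i n).
Proof. by move=> hE n; rewrite /num /raw_map fstcK (code_val_map hE). Qed.

Lemma den_map (h : {rmorphism F -> F'}) : (forall a, h (fp_phi i a) = fp_phi i' (f a)) ->
  forall n, den i' (raw_map f n) = coef_map h (den i n).
Proof. by move=> hE n; rewrite /den /raw_map sndcK (code_val_map hE). Qed.

Lemma valid_map n : valid i n -> valid i' (raw_map f n).
Proof.
have [h hE] := field_morphism; move=> /validP n0; apply/validP.
by rewrite (den_map hE) -(coef_map0 h) => /coef_map_inj.
Qed.

Lemma raw_val_map n m : valid i n -> valid i m ->
  raw_val i' (raw_map f n) = raw_val i' (raw_map f m) <-> raw_val i n = raw_val i m.
Proof.
have [h hE] := field_morphism => vn vm.
rewrite (raw_val_eq vn vm) (raw_val_eq (valid_map vn) (valid_map vm)).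
rewrite !(num_map hE) !(den_map hE) -!coef_mapM; split=> [/coef_map_inj //|-> //].
Qed.

Lemma raw_val_map_add n m : valid i n -> valid i m ->
  raw_val i' (raw_map f (raw_add n m)) = raw_val i' (raw_map f n) + raw_val i' (raw_map f m).
Proof.
move=> vn vm; have [h hE] := field_morphism.
have v1 := valid_map vn; have v2 := valid_map vm; rewrite -(raw_val_add v1 v2).
have vnm := valid_map (valid_denM vn vm (den_add i n m)).
apply/(raw_val_eq vnm (valid_denM v1 v2 (den_add i' _ _))).
rewrite num_add den_add !(num_map hE) !(den_map hE) num_add den_add.
by rewrite coef_mapD !coef_mapM.
Qed.

Lemma raw_val_map_mul n m : valid i n -> valid i m ->
  raw_val i' (raw_map f (raw_mul n m)) = raw_val i' (raw_map f n) * raw_val i' (raw_map f m).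
Proof.
move=> vn vm; have [h hE] := field_morphism.
have v1 := valid_map vn; have v2 := valid_map vm; rewrite -raw_val_mul.
have vnm := valid_map (valid_denM vn vm (den_mul i n m)).
apply/(raw_val_eq vnm (valid_denM v1 v2 (den_mul i' _ _))).
by rewrite num_mul den_mul !(num_map hE) !(den_map hE) num_mul den_mul !coef_mapM.
Qed.

Lemma raw_val_map_one : raw_val i' (raw_map f (raw_one i)) = 1.
Proof.
have [h hE] := field_morphism; rewrite -raw_val_one.
have v1 := valid_den1 (den_one i); apply/(raw_val_eq (valid_map v1) (valid_den1 (den_one i'))).
by rewrite (num_map hE) (den_map hE) num_one den_one num_one den_one mulrC.
Qed.

Lemma raw_val_map_zero : raw_val i' (raw_map f (raw_zero i)) = 0.
Proof.
have [h hE] := field_morphism; rewrite -raw_val_zero.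
have v1 := valid_den1 (den_zero i); apply/(raw_val_eq (valid_map v1) (valid_den1 (den_zero i'))).
by rewrite (num_map hE) num_zero num_zero coef_map0 !mul0r.
Qed.

(** Renaming parameters need not take least codes to least codes, so the value of the renamed code
    is looked up anew. *)
Definition Kmap k : nat := Kidx (raw_val i' (raw_map f (enum_rep i k))).

Lemma Kphi_Kmap k : Kphi i' (Kmap k) = raw_val i' (raw_map f (enum_rep i k)).
Proof. exact: KidxK. Qed.

(** Any valid code of an element may replace its representative. Compatibility with the operations
    and with composition rests on this, since sums, products and renamings of representatives need
    not be representatives. *)
Lemma Kphi_Kmap_val k n : valid i n -> Kphi i k = raw_val i n -> Kphi i' (Kmap k) = raw_val i' (raw_map f n).
Proof.
by move=> vn E; rewrite Kphi_Kmap; apply/(raw_val_map (rep_valid (enum_rep_rep i k)) vn).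
Qed.

End Transfer.

Lemma raw_val_ext i n m : num i n = num i m -> den i n = den i m ->
  raw_val i n = raw_val i m.
Proof. by move=> nE dE; apply: sfval_inj; rewrite !raw_valE nE dE. Qed.

Lemma term_map_comp f g t : term_map f (term_map g t) = term_map (f \o g) t.
Proof. by elim: t => //= s -> t ->. Qed.

Lemma term_map_id f t : f =1 id -> term_map f t = t.
Proof. by move=> fE; elim: t => //= [a|s -> t ->|s -> t ->] //; rewrite fE. Qed.

Lemma code_map_comp f g c : code_map f (code_map g c) = code_map (f \o g) c.
Proof. by rewrite /code_map term_codeK term_map_comp. Qed.

Lemma raw_map_comp f g n : raw_map f (raw_map g n) = raw_map (f \o g) n.
Proof. by rewrite {1}/raw_map /raw_map fstcK sndcK !code_map_comp. Qed.

Lemma raw_val_map_id i f n : f =1 id -> raw_val i (raw_map f n) = raw_val i n.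
Proof.
move=> fE; apply: raw_val_ext; rewrite /num /den /raw_map ?fstcK ?sndcK;
by rewrite /code_val /code_map term_codeK term_map_id.
Qed.

(** Renaming composes strictly on codes; [Kphi_Kmap_val] absorbs the change of representative in the
    middle structure. *)
Lemma Kmap_comp (i i' i'' : fpres) f f'
    (If : iso (fp_str i) (fp_str i') f) (If' : iso (fp_str i') (fp_str i'') f')
    (If'' : iso (fp_str i) (fp_str i'') (f' \o f)) k :
  Kmap (FIso If'') k = Kmap (FIso If') (Kmap (FIso If) k).
Proof.
have e1 : Kphi i'' (Kmap (FIso If'') k) = raw_val i'' (raw_map (f' \o f) (enum_rep i k)).
  exact: (Kphi_Kmap (FIso If'') k).
have e2 : Kphi i' (Kmap (FIso If) k) = raw_val i' (raw_map f (enum_rep i k)).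
  exact: (Kphi_Kmap (FIso If) k).
have v : valid i' (raw_map f (enum_rep i k)).
  exact: (valid_map (j := FIso If) (rep_valid (enum_rep_rep i k))).
have e3 : Kphi i'' (Kmap (FIso If') (Kmap (FIso If) k)) =
    raw_val i'' (raw_map f' (raw_map f (enum_rep i k))).
  exact: (Kphi_Kmap_val (j := FIso If') v e2).
by apply: (@Kphi_inj i''); rewrite e1 e3 raw_map_comp.
Qed.

Lemma Kmap_id (i : fpres) f (Ii : iso (fp_str i) (fp_str i) f) k : f =1 id ->
  Kmap (FIso Ii) k = k.
Proof.
move=> fE; have e : Kphi i (Kmap (FIso Ii) k) = raw_val i (raw_map f (enum_rep i k)).
  exact: (Kphi_Kmap (FIso Ii) k).
by apply: (@Kphi_inj i); rewrite e raw_val_map_id.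
Qed.

(** Functoriality supplies the inverse, namely the map induced by the inverse isomorphism. *)
Lemma Kmap_bij (j : fiso) : bijective (Kmap j).
Proof.
case: j => i i' f If; have [g fK gK] := iso_bij If.
have Ig := iso_inv fK gK If.
have Ii : iso (fp_str i) (fp_str i) (g \o f).
  by split=> [|||a b|a b] /=; rewrite ?fK //; exists id => x /=; rewrite fK.
have Ii' : iso (fp_str i') (fp_str i') (f \o g).
  by split=> [|||a b|a b] /=; rewrite ?gK //; exists id => x /=; rewrite gK.
exists (Kmap (FIso Ig)) => k.
  by rewrite -(Kmap_comp If Ig Ii); apply: Kmap_id => x /=; rewrite fK.
by rewrite -(Kmap_comp Ig If Ii'); apply: Kmap_id => x /=; rewrite gK.
Qed.

Lemma Kmap_iso (j : fiso) : iso (Kstr (fi_src j)) (Kstr (fi_tgt j)) (Kmap j).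
Proof.
have ve k := rep_valid (enum_rep_rep (fi_src j) k).
have mapE n x : valid (fi_src j) n -> raw_val (fi_src j) n = x ->
    Kphi (fi_tgt j) (Kmap j (Kidx x)) = raw_val (fi_tgt j) (raw_map (fi_map j) n).
  by move=> vn nx; apply: Kphi_Kmap_val => //; rewrite KidxK.
split=> [|||a b|a b]; first exact: Kmap_bij.
- apply: (@Kphi_inj (fi_tgt j)); rewrite [RHS](@KidxK (fi_tgt j)) -(raw_val_map_zero j).
  by apply: mapE (raw_val_zero _); apply/valid_den1/den_zero.
- apply: (@Kphi_inj (fi_tgt j)); rewrite [RHS](@KidxK (fi_tgt j)) -(raw_val_map_one j).
  by apply: mapE (raw_val_one _); apply/valid_den1/den_one.
- apply: (@Kphi_inj (fi_tgt j)); rewrite [RHS](@KidxK (fi_tgt j)) (Kphi_Kmap j a) (Kphi_Kmap j b).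
  rewrite -(raw_val_map_add (ve a) (ve b)); apply: mapE.
    exact: valid_denM (ve a) (ve b) (den_add _ _ _).
  exact: raw_val_add (ve a) (ve b).
- apply: (@Kphi_inj (fi_tgt j)); rewrite [RHS](@KidxK (fi_tgt j)) (Kphi_Kmap j a) (Kphi_Kmap j b).
  rewrite -(raw_val_map_mul (ve a) (ve b)); apply: mapE.
    exact: valid_denM (ve a) (ve b) (den_mul _ _ _).
  exact: raw_val_mul.
Qed.

Lemma code_mapE f c : code_map f c = tfold 0 1 (fun a => code_par (f a)) code_add code_mul
  (code_mul 1) (term_decode c).
Proof.
rewrite /code_map; elim: (term_decode c) => [||a|s IHs t IHt|s IHs t IHt] //=.
  by rewrite IHs IHt.
by case: s IHs => [||a|s1 s2|s1 s2] IHs; rewrite IHt ?IHs.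
Qed.

Section MapProgram.

(** In [iso_oracle] the source diagram occupies the positions 4 n, the isomorphism the positions 4 n
    + 2, and the target diagram the positions 2 n + 1. *)
Lemma cmp_src : cmp1 fi_oracle (fun j n => fp_oracle (fi_src j) n).
Proof.
have h : cmp fi_oracle 1 (fun j v => fi_oracle j (2 * (2 * nth 0%N v 0))%N).
  by apply: cmp_oracle; cmp_auto.
apply: cmp_ext h => j v _; set n := nth 0%N v 0.
by rewrite /fi_oracle /iso_oracle /join !mul2n odd_double doubleK odd_double doubleK.
Qed.

Lemma cmp_map : cmp1 fi_oracle fi_map.
Proof.
have h : cmp fi_oracle 1 (fun j v => fi_oracle j (2 * (2 * nth 0%N v 0).+1)%N).
  by apply: cmp_oracle; cmp_auto.
apply: cmp_ext h => j v _; set n := nth 0%N v 0.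
by rewrite /fi_oracle /iso_oracle /join !mul2n odd_double doubleK /= odd_double uphalf_double.
Qed.

Lemma cmp_tgt : cmp1 fi_oracle (fun j n => fp_oracle (fi_tgt j) n).
Proof.
have h : cmp fi_oracle 1 (fun j v => fi_oracle j (2 * nth 0%N v 0).+1).
  by apply: cmp_oracle; cmp_auto.
apply: cmp_ext h => j v _; set n := nth 0%N v 0.
by rewrite /fi_oracle /iso_oracle /join !mul2n /= odd_double uphalf_double.
Qed.

Lemma cmp_raw_map : cmp1 fi_oracle (fun j n => raw_map (fi_map j) n).
Proof.
have hf := cmp_map.
have h : cmp2 fi_oracle (fun j p c => tfold 0 1 (fun a => code_par (fi_map j a)) code_add code_mul
    (code_mul 1) (term_decode c)).
  apply: (cmp_tfold (z := fun _ _ => 0%N) (u := fun _ _ => 1%N)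
    (par := fun j _ a => code_par (fi_map j a)) (add := fun _ _ => code_add)
    (mul := fun _ _ => code_mul) (ksi := fun _ _ => code_mul 1));
    rewrite /code_par /code_add /code_mul; try by cmp_auto.
  rewrite /cmp2; do ?[exact: (app1 hf (cmp_proj _ 2 1)) | cmp_step].
have hc : cmp1 fi_oracle (fun j c => code_map (fi_map j) c).
  apply: cmp_ext (app2 h (cmp_const _ 1 0) (cmp_proj _ 1 0)) => j v _.
  by rewrite code_mapE.
by refine (app2 (cmp_pair _) (app1 hc _) (app1 hc _)); cmp_auto.
Qed.

(** The classically chosen index is computable because it is the only one whose representative has
    the value of the renamed code, and [raw_eq] in the target decides this. *)
Lemma cmp_Kmap : cmp1 fi_oracle Kmap.
Proof.
have he : cmp1 fi_oracle (fun j k => enum_rep (fi_src j) k) := cmp_relativize cmp_src cmp_enum_rep.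
have he' : cmp1 fi_oracle (fun j k => enum_rep (fi_tgt j) k) := cmp_relativize cmp_tgt cmp_enum_rep.
have hq : cmp2 fi_oracle (fun j n m => raw_eq (fi_tgt j) n m) := cmp_relativize cmp_tgt cmp_raw_eq.
have hm := cmp_raw_map.
have h : cmp2 fi_oracle (fun j k' k => raw_eq (fi_tgt j) (enum_rep (fi_tgt j) k')
    (raw_map (fi_map j) (enum_rep (fi_src j) k))).
  exact: (app2 hq (app1 he' (cmp_proj _ 2 0)) (app1 hm (app1 he (cmp_proj _ 2 1)))).
move/cmp_search: h; apply=> j v _; set k := nth 0%N v 0.
have ve' k' := rep_valid (enum_rep_rep (fi_tgt j) k').
have vm := valid_map (rep_valid (enum_rep_rep (fi_src j) k)).
split=> [|k']; first by apply/(raw_eqP (ve' _) vm); apply: Kphi_Kmap.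
move/(raw_eqP (ve' _) vm) => E.
suff -> : Kmap j k = k' by [].
by apply: (@Kphi_inj (fi_tgt j)); rewrite Kphi_Kmap -E.
Qed.

End MapProgram.

(** Equality of structures, not just isomorphism, lets every [B] with [maps_to Phi A B] be replaced
    by the constructed structure. *)
Lemma diagram_structure (A B : structure) : diagram A =1 diagram B -> A = B.
Proof.
move/diagram_inj; case: A B => z u a m [z' u' a' m'] /= [-> -> aE mE].
by congr Structure; apply/funext => x; apply/funext => y.
Qed.

Lemma FD_fpres r A : FD r A -> exists i, fp_str i = A /\ has_trdeg (fp_field i) r.
Proof.
by case=> F [phi [pA cF tF]]; exists (FPres pA cF).
Qed.

Lemma Kstr_reflects (i i' : fpres) :
  isomorphic (Kstr i) (Kstr i') -> isomorphic (fp_str i) (fp_str i').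
Proof.
case=> g Ig; have [g' gK g'K] := iso_bij Ig.
have [th thE] := presents_morphism (Kstr_presents i) (Kstr_presents i') Ig.
have [ht htE] := presents_morphism (Kstr_presents i') (Kstr_presents i) (iso_inv gK g'K Ig).
have thK : cancel th ht.
  by move=> x; have [k <-] := Kphi_surj x; rewrite thE htE gK.
have htK : cancel ht th.
  by move=> x; have [k <-] := Kphi_surj x; rewrite htE thE g'K.
have [h bh] := recover (fp_char0 i) (fp_char0 i') thK htK.
exact: presents_iso (fp_presents i) (fp_presents i') bh.
Qed.

Theorem theorem5p8 (r : nat) :
  exists Phi Phis : program,
    tc_embedding (FD r) (FD r.+1) Phi /\ functorial (FD r) Phi Phis.
Proof.
have [Phi hPhi] := cmp_diagram_Kstr; have [Phis hPhis] := cmp_Kmap.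
have mapsK i : maps_to Phi (fp_str i) (Kstr i) by move=> n; apply: (hPhi i [:: n]).
have mapsU i B : maps_to Phi (fp_str i) B -> B = Kstr i.
  move=> hB; apply: diagram_structure => n.
  (* Outputs are booleans read as numbers, and equal numbers come from equal booleans. *)
  by have := eval_fun (hB n) (mapsK i n); do 2!case: diagram.
have compK j : computes Phis (fi_oracle j) (Kmap j) by move=> n; apply: (hPhis j [:: n]).
have compU j g : computes Phis (fi_oracle j) g -> g =1 Kmap j.
  by move=> hg n; apply: eval_fun (hg n) (compK j n).
exists Phi, Phis; split; split.
- move=> _ /FD_fpres[i [<- tF]]; exists (Kstr i) => //; exact: FD_Kstr.
- move=> _ _ B B' /FD_fpres[i [<- _]] /FD_fpres[i' [<- _]] /mapsU -> /mapsU ->.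
  split; last exact: Kstr_reflects.
  by case=> f If; exists (Kmap (FIso If)); apply: (Kmap_iso (FIso If)).
- move=> _ _ B B' f /FD_fpres[i [<- _]] /FD_fpres[i' [<- _]] If /mapsU -> /mapsU ->.
  by exists (Kmap (FIso If)); [apply: (compK (FIso If))|apply: (Kmap_iso (FIso If))].
- move=> _ /FD_fpres[i [<- _]] n.
  have Ii : iso (fp_str i) (fp_str i) id by split=> //; exists id.
  by have := compK (FIso Ii) n; rewrite Kmap_id.
- move=> _ _ _ f f' g g' /FD_fpres[i [<- _]] /FD_fpres[i' [<- _]] /FD_fpres[i'' [<- _]].
  move=> If If' /(compU (FIso If)) gE /(compU (FIso If')) g'E n.
  have If'' : iso (fp_str i) (fp_str i'') (f' \o f).
    split=> [|||a b|a b] /=; first exact: bij_comp (iso_bij If') (iso_bij If).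
    + by rewrite (iso_zero If) (iso_zero If').
    + by rewrite (iso_one If) (iso_one If').
    + by rewrite (iso_add If) (iso_add If').
    + by rewrite (iso_mul If) (iso_mul If').
  by have := compK (FIso If'') n; rewrite (Kmap_comp If If') /= gE g'E.
Qed.
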